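(* Let $a,b\in\mathbb{C}$. The compatible noncommutative TPCA structures $\circ_\lambda$ over the Lie conformal algebra $W(a,b)=\mathbb{C}[\partial]L\oplus\mathbb{C}[\partial]M$ are exactly those given on generators by the following forms: (1) If $a\neq2$: $L\circ_\lambda L=L\circ_\lambda M=M\circ_\lambda L=M\circ_\lambda M=0$. (2) If $a=2$, one of: (2.1) $L\circ_\lambda L=s(\lambda)M$, $\ L\circ_\lambda M=M\circ_\lambda L=M\circ_\lambda M=0$; (2.2) $L\circ_\lambda L=c_1L+c_2\lambda M$, $\ L\circ_\lambda M=c_1M$, $\ M\circ_\lambda L=M\circ_\lambda M=0$; (2.3) $L\circ_\lambda L=c_1L+c_3M$, $\ L\circ_\lambda M=M\circ_\lambda L=c_1M$, $\ M\circ_\lambda M=0$; (2.4) $L\circ_\lambda L=(m-k\lambda)L+\left(\frac{km}{c_0}\lambda-\frac{k^2}{c_0}\lambda^2\right)M$, $\ L\circ_\lambda M=(m-k\lambda)M$, $\ M\circ_\lambda L=c_0L+k\lambda M$, $\ M\circ_\lambda M=c_0M$; where $s(\lambda)\in\mathbb{C}[\lambda]$, $c_0,c_1\in\mathbb{C}\setminus\{0\}$, and $c_2,c_3,m,k\in\mathbb{C}$.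
   Context: All vector spaces, linear maps and tensor products are over $\mathbb{C}$. For a vector space $A$, $A[\lambda]$ denotes polynomials in $\lambda$ with coefficients in $A$. A conformal algebra $(A,\circ_\lambda)$ is a $\mathbb{C}[\partial]$-module $A$ with a $\mathbb{C}$-bilinear map $A\otimes A\to A[\lambda]$, $x\otimes y\mapsto x\circ_\lambda y$, such that $(\partial x)\circ_\lambda y=-\lambda\, x\circ_\lambda y$ and $x\circ_\lambda(\partial y)=(\partial+\lambda)(x\circ_\lambda y)$; it is associative if $x\circ_\lambda(y\circ_\mu z)=(x\circ_\lambda y)\circ_{\lambda+\mu}z$ for all $x,y,z$. Products are extended linearly to polynomials in formal variables; if $[x_\lambda y]=\sum_n\lambda^n w_n$, then $[x_{-\lambda-\partial}y]=\sum_n(-\lambda-\partial)^n w_n$. A Lie conformal algebra $(A,[\cdot_\lambda\cdot])$ is a conformal algebra (with product written $[x_\lambda y]$) such that $[x_\lambda y]=-[y_{-\lambda-\partial}x]$ and $[x_\lambda[y_\mu z]]=[[x_\lambda y]_{\lambda+\mu}z]+[y_\mu[x_\lambda z]]$ for all $x,y,z$. For $a,b\in\mathbb{C}$, $W(a,b)$ is the Lie conformal algebra that is the free $\mathbb{C}[\partial]$-module on $L,M$ with $[L_\lambda L]=(\partial+2\lambda)L$, $[L_\lambda M]=(\partial+a\lambda+b)M$, $[M_\lambda M]=0$ (with $[M_\lambda L]$ determined by skew-symmetry). A (compatible) noncommutative TPCA structure over a Lie conformal algebra $(A,[\cdot_\lambda\cdot])$ is a $\lambda$-multiplication $\circ_\lambda$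 on the $\mathbb{C}[\partial]$-module $A$ such that $(A,\circ_\lambda)$ is an associative conformal algebra (not necessarily commutative) and $2(x\circ_\lambda[y_\mu z])=[(x\circ_\lambda y)_{\lambda+\mu}z]+[y_\mu(x\circ_\lambda z)]$ for all $x,y,z\in A$. By sesquilinearity such a structure on $W(a,b)$ is determined by the products of the generators $L,M$. *)

(* Defs.v *)
From HB Require Import structures.
From mathcomp Require Import all_boot all_order all_algebra.
From mathcomp Require Import reals complex finmap.
From mathcomp Require Import monalg.
From mathcomp Require Import ring.

Set Implicit Arguments.
Unset Strict Implicit.
Unset Printing Implicit Defensive.

Import GRing.Theory.

Local Open Scope ring_scope.

Definition complexField (R : realType) : fieldType := R[i].

(* [lpoly V] is V[X], the polynomials in one formal variable with coefficients
   in an R-module V, i.e. finitely supported functions [nat -> V]; it is a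
   module over R[X].  Iterating, [lpoly (lpoly V)] is V[X][Y], a module over
   R[X][Y]. *)
Definition lpoly (R : nzRingType) (V : lmodType R) : Type := {malg V[nat]}.
HB.instance Definition _ (R : nzRingType) (V : lmodType R) :=
  GRing.Zmodule.on (lpoly V).

Section LPolyZmod.
Variables (R : nzRingType) (V : lmodType R).
Implicit Types (v : V) (w : lpoly V).

Definition cst v : lpoly V := << v *g 0%N >>.

Definition lcoef (n : nat) w : V := mcoeff n w.

(* 1 + the degree, for w != 0 *)
Definition lsize w : nat := (\max_(j <- (msupp w : seq nat)) j).+1.

Lemma lpolyP w1 w2 : (forall n, lcoef n w1 = lcoef n w2) <-> w1 = w2.
Proof. exact: malgP. Qed.

Lemma lcoefB n : {morph lcoef n : w1 w2 / w1 - w2}.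
Proof. by move=> w1 w2; rewrite /lcoef mcoeffB. Qed.

HB.instance Definition _ n :=
  GRing.isZmodMorphism.Build (lpoly V) V (lcoef n) (@lcoefB n).

Lemma cst_is_zmod_morphism : {morph cst : v1 v2 / v1 - v2}.
Proof. by move=> v1 v2; rewrite /cst monalgUB. Qed.

HB.instance Definition _ :=
  GRing.isZmodMorphism.Build V (lpoly V) cst cst_is_zmod_morphism.

Lemma lcoef_default n w : (lsize w <= n)%N -> lcoef n w = 0.
Proof.
move=> h; apply: mcoeff_outdom; apply/negP => nw.
by move: h; rewrite /lsize ltnNge (leq_bigmax_seq (F := id)).
Qed.

Lemma lcoefU n k v : lcoef n (<< v *g k >> : lpoly V) = if k == n then v else 0.
Proof. by rewrite /lcoef mcoeffU; case: eqP; rewrite ?mulr1n ?mulr0n. Qed.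

Lemma lcoef_cst n v : lcoef n (cst v) = if n == 0%N then v else 0.
Proof. by rewrite lcoefU eq_sym. Qed.

Lemma sum_lcoef (W : nmodType) (f : nat -> V -> W) w m :
  (forall n, f n 0 = 0) -> (lsize w <= m)%N ->
  \sum_(n < lsize w) f n (lcoef n w) = \sum_(n < m) f n (lcoef n w).
Proof.
move=> f0 le_m; rewrite -!(big_mkord xpredT (fun n => f n (lcoef n w))).
rewrite (@big_cat_nat _ _ _ (lsize w) 0 m) //=.
rewrite [X in _ = _ + X]big_nat_cond [X in _ = _ + X]big1 ?addr0 //.
by move=> n /andP[/andP[le_n _] _]; rewrite lcoef_default.
Qed.

End LPolyZmod.

Section LPoly.
Variables (R : nzRingType) (V : lmodType R).
Implicit Types (p q : {poly R}) (w : lpoly V).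

Definition lpoly_scale p w : lpoly V :=
  \sum_(i < size p) \sum_(j < lsize w) << p`_i *: lcoef j w *g (i + j)%N >>.

Lemma lcoef_scale p w k :
  lcoef k (lpoly_scale p w) = \sum_(i < k.+1) p`_i *: lcoef (k - i) w.
Proof.
have inner (c : R) (i : nat) :
    lcoef k (\sum_(j < lsize w) << c *: lcoef j w *g (i + j)%N >>) =
    if (i <= k)%N then c *: lcoef (k - i) w else 0.
  rewrite raddf_sum /=.
  rewrite (@sum_lcoef _ _ _ (fun j v => lcoef k (<< c *: v *g (i + j)%N >> : lpoly V))
            w (lsize w + k.+1)) ?leq_addr //; last first.
    by move=> n; rewrite lcoefU scaler0 if_same.
  under eq_bigr do rewrite lcoefU.
  case: leqP => [le_ik|lt_ki].
    have lt_k : (k - i < lsize w + k.+1)%N.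
      by rewrite (leq_ltn_trans (leq_subr _ _)) // addnS ltnS leq_addl.
    rewrite (bigD1 (Ordinal lt_k)) //= subnKC // eqxx big1 ?addr0 // => j.
    rewrite -val_eqE /= => /eqP ne_j; case: eqP => // e.
    by case: ne_j; rewrite -[X in (X - i)%N]e addKn.
  by rewrite big1 // => j _; case: eqP => // e; rewrite -e ltnNge leq_addr in lt_ki.
rewrite /lpoly_scale raddf_sum /=.
under eq_bigr do rewrite inner.
pose F i := if (i <= k)%N then p`_i *: lcoef (k - i) w else 0.
rewrite -(big_mkord xpredT F) -(big_mkord xpredT (fun i => p`_i *: lcoef (k - i) w)).
have -> : \sum_(0 <= i < k.+1) p`_i *: lcoef (k - i) w = \sum_(0 <= i < k.+1) F i.
  by apply: eq_big_nat => i /andP[_]; rewrite ltnS /F => ->.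
have [le_pk|lt_kp] := leqP (size p) k.+1.
  rewrite [RHS](@big_cat_nat _ _ _ (size p)) //= [X in _ = _ + X]big_nat_cond.
  rewrite [X in _ = _ + X]big1 ?addr0 // => i /andP[/andP[le_i _] _].
  by rewrite /F nth_default // scale0r if_same.
rewrite [LHS](@big_cat_nat _ _ _ k.+1) //=; last exact: ltnW.
rewrite [X in _ + X]big_nat_cond [X in _ + X]big1 ?addr0 //.
by move=> i /andP[/andP[lt_ki _] _]; rewrite /F leqNgt lt_ki.
Qed.

Fact lpoly_scale1 : left_id 1 lpoly_scale.
Proof.
move=> w; apply/lpolyP => k; rewrite lcoef_scale big_ord_recl subn0 coef1 scale1r.
by rewrite big1 ?addr0 // => i _; rewrite coef1 scale0r.
Qed.

Fact lpoly_scaleDr : right_distributive lpoly_scale +%R.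
Proof.
move=> p w1 w2; apply/lpolyP => k; rewrite raddfD /= !lcoef_scale -big_split.
by apply: eq_bigr => i _ /=; rewrite raddfD scalerDr.
Qed.

Fact lpoly_scaleDl w : {morph lpoly_scale^~ w : p q / p + q}.
Proof.
move=> p q; apply/lpolyP => k; rewrite raddfD /= !lcoef_scale -big_split.
by apply: eq_bigr => i _ /=; rewrite coefD scalerDl.
Qed.

Lemma lpoly_scaleC (c : R) w k : lcoef k (lpoly_scale c%:P w) = c *: lcoef k w.
Proof.
rewrite lcoef_scale big_ord_recl subn0 coefC eqxx big1 ?addr0 // => i _.
by rewrite coefC scale0r.
Qed.

Lemma lpoly_scaleMX p w k :
  lcoef k (lpoly_scale (p * 'X) w) =
  if k is k'.+1 then lcoef k' (lpoly_scale p w) else 0.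
Proof.
rewrite lcoef_scale big_ord_recl coefMX /= scale0r add0r.
case: k => [|k]; first by rewrite big_ord0.
by rewrite lcoef_scale; apply: eq_bigr => i _; rewrite coefMX.
Qed.

Fact lpoly_scaleA p q w :
  lpoly_scale p (lpoly_scale q w) = lpoly_scale (p * q) w.
Proof.
apply/lpolyP; elim/poly_ind: p => [|p c IH] k.
  rewrite mul0r !lcoef_scale !big1 // => i _.
    by rewrite coef0 scale0r.
  by rewrite coef0 scale0r.
rewrite mulrDl !lpoly_scaleDl !raddfD /=; congr (_ + _).
  rewrite -mulrA -commr_polyX mulrA !lpoly_scaleMX.
  by case: k => [|k]; rewrite ?IH.
rewrite lpoly_scaleC !lcoef_scale scaler_sumr; apply: eq_bigr => i _.
by rewrite coefCM scalerA.
Qed.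

HB.instance Definition _ := GRing.Zmodule_isLmodule.Build {poly R} (lpoly V)
  lpoly_scaleA lpoly_scale1 lpoly_scaleDr lpoly_scaleDl.

Lemma lcoefZC (c : R) w n : lcoef n (c%:P *: w) = c *: lcoef n w.
Proof. exact: lpoly_scaleC. Qed.

Lemma lcoefZX w n : lcoef n ('X *: w) = if n is n'.+1 then lcoef n' w else 0.
Proof.
have := lpoly_scaleMX 1 w n; rewrite mul1r => ->; case: n => // n.
by rewrite lpoly_scale1.
Qed.

Lemma cstZ (c : R) (v : V) : cst (c *: v) = c%:P *: cst v.
Proof.
by apply/lpolyP => n; rewrite lcoefZC !lcoef_cst; case: eqP; rewrite ?scaler0.
Qed.

End LPoly.

(* [subst f r w] is w with its variable replaced by the scalar r of the target
   module W, and its coefficients carried into W by f. *)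
Definition subst (R S : nzRingType) (V : lmodType R) (W : lmodType S)
    (f : V -> W) (r : S) (w : lpoly V) : W :=
  \sum_(n < lsize w) r ^+ n *: f (lcoef n w).

Section SubstTheory.
Variables (R S : nzRingType) (V : lmodType R) (W : lmodType S).
Variables (f : V -> W).
Hypothesis fB : {morph f : x y / x - y}.
Implicit Types (r : S) (w : lpoly V).

Let f0 : f 0 = 0. Proof. by rewrite -(subrr 0) fB subrr. Qed.

Lemma substE r w m : (lsize w <= m)%N ->
  subst f r w = \sum_(n < m) r ^+ n *: f (lcoef n w).
Proof.
by apply: (@sum_lcoef _ _ _ (fun n v => r ^+ n *: f v)) => n; rewrite f0 scaler0.
Qed.

Lemma substB r : {morph subst f r : w1 w2 / w1 - w2}.
Proof.
move=> w1 w2; pose m := maxn (lsize (w1 - w2)) (maxn (lsize w1) (lsize w2)).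
rewrite !(@substE r _ m) ?leq_max ?leqnn ?orbT // -sumrB; apply: eq_bigr => n _.
by rewrite raddfB /= fB scalerBr.
Qed.

Lemma substD r : {morph subst f r : w1 w2 / w1 + w2}.
Proof.
move=> w1 w2; have N x : subst f r (- x) = - subst f r x.
  by rewrite -sub0r substB -(subrr 0) substB subrr sub0r.
by rewrite -{1}(opprK w2) substB N opprK.
Qed.

Lemma subst0 r : subst f r 0 = 0.
Proof. by rewrite -(subrr 0) substB subrr. Qed.

Lemma substN r w : subst f r (- w) = - subst f r w.
Proof. by rewrite -sub0r substB subst0 sub0r. Qed.

Lemma subst_cst r v : subst f r (cst v) = f v.
Proof.
rewrite (@substE _ _ (lsize (cst v)).+1) //.
rewrite big_ord_recl lcoef_cst expr0 scale1r big1 ?addr0 // => n _.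
by rewrite lcoef_cst f0 scaler0.
Qed.
End SubstTheory.

Section SubstScale.
Variables (R S : nzRingType) (V : lmodType R) (W : lmodType S).
Variables (f : V -> W).
Hypothesis fB : {morph f : x y / x - y}.
Implicit Types (r : S) (w : lpoly V).

Lemma substZX r w : subst f r ('X *: w) = r *: subst f r w.
Proof.
pose m := maxn (lsize ('X *: w)) (lsize w).+1.
rewrite (substE fB _ (m := m.+1)) ?(substE fB _ (m := m)) //.
- rewrite big_ord_recl lcoefZX -(subrr 0) fB subrr scaler0 add0r scaler_sumr.
  by apply: eq_bigr => n _; rewrite lcoefZX exprS scalerA.
- by rewrite leq_max leqnSn orbT.
- by rewrite leqW // leq_max leqnn.
Qed.
End SubstScale.

Section SubstScaleC.
Variables (R : nzRingType) (S : comNzRingType) (V : lmodType R) (W : lmodType S).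
Variables (f : V -> W).
Hypothesis fB : {morph f : x y / x - y}.
Implicit Types (r : S) (w : lpoly V).

Lemma substZC (c : R) (d : S) r w : (forall v, f (c *: v) = d *: f v) ->
  subst f r (c%:P *: w) = d *: subst f r w.
Proof.
move=> fc; pose m := maxn (lsize (c%:P *: w)) (lsize w).
rewrite !(substE fB _ (m := m)) ?leq_max ?leqnn ?orbT // scaler_sumr.
by apply: eq_bigr => n _; rewrite lcoefZC fc !scalerA mulrC.
Qed.
End SubstScaleC.

(* C[∂]-modules are modules A over {poly K}, with ∂ acting as 'X.
   In {poly {poly K}} = K[∂][λ]:            ∂ = 'X%:P,     λ = 'X.
   In {poly {poly {poly K}}} = K[∂][λ][μ]:  ∂ = 'X%:P%:P,  λ = 'X%:P,  μ = 'X. *)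
Section Conformal.
Variables (K : fieldType) (A : lmodType {poly K}).
Implicit Types (m br : A -> A -> lpoly A) (x y z : A) (w : lpoly A).
Implicit Types (r s : {poly {poly {poly K}}}).

Definition cst2 x : lpoly (lpoly A) := cst (cst x).

(* x ∘_r y, in A[λ][μ] *)
Definition prodat m r x y : lpoly (lpoly A) := subst cst2 r (m x y).

(* x ∘_r w(s) and w(s) ∘_r z, in A[λ][μ], for w(λ) in A[λ] *)
Definition prodatr m r s x w : lpoly (lpoly A) := subst (prodat m r x) s w.
Definition prodatl m r s w z : lpoly (lpoly A) :=
  subst (fun v => prodat m r v z) s w.

Record conformal m : Prop := Conformal {
  conformal_addl : forall x1 x2 y, m (x1 + x2) y = m x1 y + m x2 y;
  conformal_addr : forall x y1 y2, m x (y1 + y2) = m x y1 + m x y2;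
  conformal_scalel : forall (c : K) x y, m (c%:P *: x) y = c%:P%:P *: m x y;
  conformal_scaler : forall (c : K) x y, m x (c%:P *: y) = c%:P%:P *: m x y;
  conformal_dl : forall x y, m ('X *: x) y = - 'X *: m x y;
  conformal_dr : forall x y, m x ('X *: y) = ('X%:P + 'X) *: m x y }.

Record assoc_conformal m : Prop := AssocConformal {
  assoc_conformal_conformal : conformal m;
  assoc_conformalA : forall x y z,
    prodatr m 'X%:P 'X x (m y z) = prodatl m ('X%:P + 'X) 'X%:P (m x y) z }.

(* [br y x] at -λ-∂ : powers of -λ-∂ act on the coefficients from the left *)
Definition skewed br y x : lpoly A := subst (@cst _ A) (- 'X - 'X%:P) (br y x).

Record lie_conformal br : Prop := LieConformal {
  lie_conformal_conformal : conformal br;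
  lie_conformal_skew : forall x y, br x y = - skewed br y x;
  lie_conformal_jacobi : forall x y z,
    prodatr br 'X%:P 'X x (br y z) =
      prodatl br ('X%:P + 'X) 'X%:P (br x y) z +
      prodatr br 'X 'X%:P y (br x z) }.

Lemma cst2B : {morph cst2 : x y / x - y}.
Proof. by move=> x y; rewrite /cst2 !raddfB. Qed.

Lemma cst2Z (p : {poly K}) x : cst2 (p *: x) = p%:P%:P *: cst2 x.
Proof. by rewrite /cst2 !cstZ. Qed.

Section Theory.
Variables (m : A -> A -> lpoly A) (mC : conformal m).

Lemma conformalBl x1 x2 y : m (x1 - x2) y = m x1 y - m x2 y.
Proof. by apply/esym/eqP; rewrite subr_eq -(conformal_addl mC) subrK. Qed.

Lemma conformalBr x y1 y2 : m x (y1 - y2) = m x y1 - m x y2.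
Proof. by apply/esym/eqP; rewrite subr_eq -(conformal_addr mC) subrK. Qed.

Lemma prodatBl r y : {morph (prodat m r)^~ y : x1 x2 / x1 - x2}.
Proof. by move=> x1 x2; rewrite /prodat conformalBl (substB cst2B). Qed.

Lemma prodatBr r x : {morph prodat m r x : y1 y2 / y1 - y2}.
Proof. by move=> y1 y2; rewrite /prodat conformalBr (substB cst2B). Qed.

Lemma prodatDl r y : {morph (prodat m r)^~ y : x1 x2 / x1 + x2}.
Proof. by move=> x1 x2; rewrite /prodat (conformal_addl mC) (substD cst2B). Qed.

Lemma prodatDr r x : {morph prodat m r x : y1 y2 / y1 + y2}.
Proof. by move=> y1 y2; rewrite /prodat (conformal_addr mC) (substD cst2B). Qed.

Lemma subst2Z (p : {poly K}) r w :
  subst cst2 r (p%:P *: w) = p%:P%:P *: subst cst2 r w.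
Proof. by apply: (substZC cst2B) => v; rewrite cst2Z. Qed.

Lemma prodatZl r (c : K) x y :
  prodat m r (c%:P *: x) y = c%:P%:P%:P *: prodat m r x y.
Proof. by rewrite /prodat (conformal_scalel mC) subst2Z. Qed.

Lemma prodatZr r (c : K) x y :
  prodat m r x (c%:P *: y) = c%:P%:P%:P *: prodat m r x y.
Proof. by rewrite /prodat (conformal_scaler mC) subst2Z. Qed.

Lemma prodatXl r x y : prodat m r ('X *: x) y = - r *: prodat m r x y.
Proof.
by rewrite /prodat (conformal_dl mC) scaleNr (substN cst2B) (substZX cst2B) scaleNr.
Qed.

Lemma prodatXr r x y :
  prodat m r x ('X *: y) = ('X%:P%:P + r) *: prodat m r x y.
Proof.
rewrite /prodat (conformal_dr mC) scalerDl (substD cst2B) (substZX cst2B).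
by rewrite subst2Z scalerDl.
Qed.

Lemma prodatrDl r s w : {morph (prodatr m r s)^~ w : x1 x2 / x1 + x2}.
Proof.
move=> x1 x2; rewrite /prodatr /subst -big_split /=; apply: eq_bigr => n _.
by rewrite prodatDl scalerDr.
Qed.

Lemma prodatrZl r s (c : K) x w :
  prodatr m r s (c%:P *: x) w = c%:P%:P%:P *: prodatr m r s x w.
Proof.
rewrite /prodatr /subst scaler_sumr; apply: eq_bigr => n _.
by rewrite prodatZl !scalerA mulrC.
Qed.

Lemma prodatrXl r s x w : prodatr m r s ('X *: x) w = - r *: prodatr m r s x w.
Proof.
rewrite /prodatr /subst scaler_sumr; apply: eq_bigr => n _.
by rewrite prodatXl !scalerA mulrC.
Qed.

Lemma prodatrDr r s x : {morph prodatr m r s x : w1 w2 / w1 + w2}.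
Proof. by move=> w1 w2; rewrite /prodatr (substD (prodatBr r x)). Qed.

Lemma prodatr0 r s x : prodatr m r s x 0 = 0.
Proof. by rewrite /prodatr (subst0 (prodatBr r x)). Qed.

Lemma prodatrN r s x w : prodatr m r s x (- w) = - prodatr m r s x w.
Proof. by rewrite /prodatr (substN (prodatBr r x)). Qed.

Lemma prodatrZr r s (c : K) x w :
  prodatr m r s x (c%:P%:P *: w) = c%:P%:P%:P *: prodatr m r s x w.
Proof. by apply: (substZC (prodatBr r x)) => v; rewrite prodatZr. Qed.

Lemma prodatrXr r s x w : prodatr m r s x ('X *: w) = s *: prodatr m r s x w.
Proof. by rewrite /prodatr (substZX (prodatBr r x)). Qed.

Lemma prodatrdr r s x w :
  prodatr m r s x ('X%:P *: w) = ('X%:P%:P + r) *: prodatr m r s x w.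
Proof. by apply: (substZC (prodatBr r x)) => v; rewrite prodatXr. Qed.

Lemma prodatr_cst r s x y : prodatr m r s x (cst y) = prodat m r x y.
Proof. by rewrite /prodatr (subst_cst (prodatBr r x)). Qed.

Lemma prodatlDr r s w : {morph prodatl m r s w : z1 z2 / z1 + z2}.
Proof.
move=> z1 z2; rewrite /prodatl /subst -big_split /=; apply: eq_bigr => n _.
by rewrite prodatDr scalerDr.
Qed.

Lemma prodatlZr r s (c : K) w z :
  prodatl m r s w (c%:P *: z) = c%:P%:P%:P *: prodatl m r s w z.
Proof.
rewrite /prodatl /subst scaler_sumr; apply: eq_bigr => n _.
by rewrite prodatZr !scalerA mulrC.
Qed.

Lemma prodatlXr r s w z :
  prodatl m r s w ('X *: z) = ('X%:P%:P + r) *: prodatl m r s w z.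
Proof.
rewrite /prodatl /subst scaler_sumr; apply: eq_bigr => n _.
by rewrite prodatXr !scalerA mulrC.
Qed.

Lemma prodatlDl r s z : {morph (prodatl m r s)^~ z : w1 w2 / w1 + w2}.
Proof. by move=> w1 w2; rewrite /prodatl (substD (prodatBl r z)). Qed.

Lemma prodatl0 r s z : prodatl m r s 0 z = 0.
Proof. by rewrite /prodatl (subst0 (prodatBl r z)). Qed.

Lemma prodatlN r s w z : prodatl m r s (- w) z = - prodatl m r s w z.
Proof. by rewrite /prodatl (substN (prodatBl r z)). Qed.

Lemma prodatlZl r s (c : K) w z :
  prodatl m r s (c%:P%:P *: w) z = c%:P%:P%:P *: prodatl m r s w z.
Proof. by apply: (substZC (prodatBl r z)) => v; rewrite prodatZl. Qed.

Lemma prodatlXl r s w z : prodatl m r s ('X *: w) z = s *: prodatl m r s w z.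
Proof. by rewrite /prodatl (substZX (prodatBl r z)). Qed.

Lemma prodatldl r s w z :
  prodatl m r s ('X%:P *: w) z = - r *: prodatl m r s w z.
Proof. by apply: (substZC (prodatBl r z)) => v; rewrite prodatXl. Qed.

Lemma prodatl_cst r s x z : prodatl m r s (cst x) z = prodat m r x z.
Proof. by rewrite /prodatl (subst_cst (prodatBl r z)). Qed.
End Theory.

Lemma skewE (r : {poly {poly K}}) w : subst (@cst _ A) r ('X *: w) = r *: subst (@cst _ A) r w.
Proof. by rewrite (substZX (@cst_is_zmod_morphism _ A)). Qed.

Lemma skewC (r : {poly {poly K}}) w (p : {poly K}) :
  subst (@cst _ A) r (p%:P *: w) = p%:P *: subst (@cst _ A) r w.
Proof. by apply: (substZC (@cst_is_zmod_morphism _ A)) => v; rewrite cstZ. Qed.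
End Conformal.

Section FreeModule.
Variables (K : fieldType) (n : nat).
Let A := 'rV[{poly K}]_n.

(* The sesquilinear extension of a table of products of the basis vectors:
   p(∂)e_i ∘_λ q(∂)e_j = p(-λ) q(∂+λ) (e_i ∘_λ e_j). *)
Definition sesquilinear (t : 'I_n -> 'I_n -> lpoly A) (x y : A) : lpoly A :=
  \sum_i \sum_j
    ((x 0 i)^:P \Po (- 'X)) * ((y 0 j)^:P \Po ('X%:P + 'X)) *: t i j.

Lemma sesquilinear_conformal t : conformal (sesquilinear t).
Proof.
split=> *; rewrite /sesquilinear ?scaler_sumr -?big_split /=;
  apply: eq_bigr => i _; rewrite ?scaler_sumr -?big_split /=;
  apply: eq_bigr => j _; rewrite !mxE ?scalerA -?scalerDl; congr (_ *: _);
  rewrite ?rmorphD ?rmorphM /= ?map_polyC ?map_polyX /= ?comp_polyD ?comp_polyM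
    ?comp_polyC ?comp_polyX; ring.
Qed.

Lemma sesquilinear_delta t i j :
  sesquilinear t (delta_mx 0 i) (delta_mx 0 j) = t i j.
Proof.
rewrite /sesquilinear (bigD1 i) //= (bigD1 j) //= !mxE !eqxx !rmorph1 /=.
rewrite mulr1 scale1r !big1 ?addr0 // => [i' ne_i|j' ne_j].
  rewrite big1 // => j' _; rewrite !mxE (negPf ne_i) andbF !rmorph0.
  by rewrite mul0r scale0r.
by rewrite !mxE (negPf ne_j) andbF !rmorph0 mulr0 scale0r.
Qed.

Lemma free_ind (P : A -> Prop) :
    (forall x y, P x -> P y -> P (x + y)) ->
    (forall (c : K) x, P x -> P (c%:P *: x)) -> (forall x, P x -> P ('X *: x)) ->
    P 0 -> (forall i, P (delta_mx 0 i)) -> forall x, P x.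
Proof.
move=> PD PZ PX P0 Pe x; rewrite (row_sum_delta x).
elim/big_rec: _ => // i y _ Py; apply: (PD) => //.
elim/poly_ind: (x 0 i) => [|p c IH]; first by rewrite scale0r.
rewrite scalerDl; apply: (PD); last by apply: PZ; apply: Pe.
by rewrite mulrC -scalerA; apply: PX.
Qed.

Lemma conformal_eq (m1 m2 : A -> A -> lpoly A) :
    conformal m1 -> conformal m2 ->
    (forall i j, m1 (delta_mx 0 i) (delta_mx 0 j) =
                 m2 (delta_mx 0 i) (delta_mx 0 j)) ->
  m1 =2 m2.
Proof.
move=> h1 h2 e12 x y; elim/free_ind: x y => [x1 x2 IH1 IH2|c x IH|x IH||i] y.
- by rewrite (conformal_addl h1) (conformal_addl h2) IH1 IH2.
- by rewrite (conformal_scalel h1) (conformal_scalel h2) IH.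
- by rewrite (conformal_dl h1) (conformal_dl h2) IH.
- by rewrite -(subrr (0 : A)) (conformalBl h1) (conformalBl h2) !subrr.
elim/free_ind: y => [y1 y2 IH1 IH2|c y IH|y IH||j].
- by rewrite (conformal_addr h1) (conformal_addr h2) IH1 IH2.
- by rewrite (conformal_scaler h1) (conformal_scaler h2) IH.
- by rewrite (conformal_dr h1) (conformal_dr h2) IH.
- by rewrite -(subrr (0 : A)) (conformalBr h1) (conformalBr h2) !subrr.
exact: e12.
Qed.

End FreeModule.

Record lieConformalAlgebra (K : fieldType) := LieConformalAlgebra {
  lca_sort :> lmodType {poly K};
  lca_bracket : lca_sort -> lca_sort -> lpoly lca_sort;
  lca_axioms : lie_conformal lca_bracket }.

(* The Jacobi identity for a conformal algebra whose C[∂]-module is spanned by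
   L and M, where br has the products of W(a, b). *)
Section Jacobi.
Variables (K : fieldType) (a b : K) (A : lmodType {poly K}) (genL genM : A).

Let lin (p q r : K) : {poly {poly K}} :=
  p%:P%:P * 'X%:P + q%:P%:P * 'X + r%:P%:P.

Variable W_ind : forall P : A -> Prop,
    (forall x y, P x -> P y -> P (x + y)) ->
    (forall (c : K) x, P x -> P (c%:P *: x)) -> (forall x, P x -> P ('X *: x)) ->
    P genL -> P genM -> forall x, P x.

Variables (br : A -> A -> lpoly A) (h : conformal br).

Let prodatr_lin r s x y p q t :
  prodatr br r s x (lin p q t *: cst y) =
  (p%:P%:P%:P * ('X%:P%:P + r) + q%:P%:P%:P * s + t%:P%:P%:P) *:
    prodat br r x y.
Proof.
rewrite /lin !scalerDl !(prodatrDr h) -!scalerA !(prodatrZr h) (prodatrdr h).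
by rewrite (prodatrXr h) (prodatr_cst h) -?scalerDl ?scalerA.
Qed.

Let prodatl_lin r s y z p q t :
  prodatl br r s (lin p q t *: cst y) z =
  (p%:P%:P%:P * (- r) + q%:P%:P%:P * s + t%:P%:P%:P) *:
    prodat br r y z.
Proof.
rewrite /lin !scalerDl !(prodatlDl h) -!scalerA !(prodatlZl h) (prodatldl h).
by rewrite (prodatlXl h) (prodatl_cst h) -?scalerDl ?scalerA.
Qed.

Let subst_lin r x p q t :
  subst (@cst2 K A) r (lin p q t *: cst x) =
  (p%:P%:P%:P * 'X%:P%:P + q%:P%:P%:P * r + t%:P%:P%:P) *: cst2 x.
Proof.
have cB := @cst2B K A.
rewrite /lin !scalerDl !(substD cB) -!scalerA !subst2Z (substZX cB).
by rewrite (subst_cst cB) ?scalerA.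
Qed.


Variable brLL : br genL genL = lin 1 2%:R 0 *: cst genL.
Variable brLM : br genL genM = lin 1 a b *: cst genM.
Variable brML : br genM genL = lin (a - 1) a (- b) *: cst genM.
Variable brMM : br genM genM = 0.

Let jacobi x y z := prodatr br 'X%:P 'X x (br y z) =
    prodatl br ('X%:P + 'X) 'X%:P (br x y) z +
    prodatr br 'X 'X%:P y (br x z).

Lemma jacobi_gen1 y z : jacobi genL y z -> jacobi genM y z ->
  forall x, jacobi x y z.
Proof.
move=> JL JM; elim/W_ind=> [x1 x2 IH1 IH2|c x IH|x IH||]; last exact: JM; last exact: JL.
all: rewrite /jacobi.
- rewrite (prodatrDl h) IH1 IH2 2!(conformal_addl h) (prodatlDl h) (prodatrDr h).
  by rewrite addrACA.
- rewrite (prodatrZl h) IH 2!(conformal_scalel h) (prodatlZl h) (prodatrZr h).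
  by rewrite scalerDr.
- rewrite (prodatrXl h) IH 2!(conformal_dl h) !scaleNr (prodatlN h) (prodatrN h).
  by rewrite (prodatlXl h) (prodatrXr h) scalerDr opprD.
Qed.

Lemma jacobi_gen2 x z : jacobi x genL z -> jacobi x genM z ->
  forall y, jacobi x y z.
Proof.
move=> JL JM; elim/W_ind=> [y1 y2 IH1 IH2|c y IH|y IH||]; last exact: JM; last exact: JL.
all: rewrite /jacobi.
- rewrite (prodatrDl h) (conformal_addl h) (prodatrDr h) IH1 IH2.
  by rewrite (conformal_addr h) (prodatlDl h) addrACA.
- rewrite (prodatrZl h) (conformal_scalel h) (prodatrZr h) IH.
  by rewrite (conformal_scaler h) (prodatlZl h) scalerDr.
- rewrite (prodatrXl h) (conformal_dl h) scaleNr (prodatrN h) (prodatrXr h) IH.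
  rewrite (conformal_dr h) scalerDl (prodatlDl h) (prodatldl h) (prodatlXl h).
  rewrite -scalerDl -scaleNr scalerDr; congr (_ *: _ + _); ring.
Qed.

Lemma jacobi_gen3 x y : jacobi x y genL -> jacobi x y genM ->
  forall z, jacobi x y z.
Proof.
move=> JL JM; elim/W_ind=> [z1 z2 IH1 IH2|c z IH|z IH||]; last exact: JM; last exact: JL.
all: rewrite /jacobi.
- rewrite 2!(conformal_addr h) (prodatlDr h) 2!(prodatrDr h) IH1 IH2.
  by rewrite addrACA.
- rewrite 2!(conformal_scaler h) (prodatlZr h) 2!(prodatrZr h) IH.
  by rewrite scalerDr.
- rewrite 2!(conformal_dr h) !scalerDl (prodatlXr h) 2!(prodatrDr h).
  rewrite 2!(prodatrdr h) 2!(prodatrXr h) -2!scalerDl IH scalerDr.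
  by congr (_ *: _ + _ *: _); [rewrite addrA | rewrite addrAC].
Qed.


Let scaler_sum2 (S : comNzRingType) (W : lmodType S) (c0 c1 c2 c3 c4 c5 : S)
    (v : W) : c0 * c1 = c2 * c3 + c4 * c5 ->
  c0 *: (c1 *: v) = c2 *: (c3 *: v) + c4 *: (c5 *: v).
Proof. by move=> e; rewrite !scalerA -scalerDl e. Qed.

Let ringLLL (S : comNzRingType) (d l m e1 e2 e0 : S) :
  e1 = 1 -> e2 = 2%:R -> e0 = 0 ->
  (e1 * (d + l) + e2 * m + e0) * (e1 * d + e2 * l + e0) =
  (e1 * - (l + m) + e2 * l + e0) * (e1 * d + e2 * (l + m) + e0) +
  (e1 * (d + m) + e2 * l + e0) * (e1 * d + e2 * m + e0).
Proof. by move=> -> -> ->; ring. Qed.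

Let ringLLM (S : comNzRingType) (d l m e1 e2 e0 p q : S) :
  e1 = 1 -> e2 = 2%:R -> e0 = 0 ->
  (e1 * (d + l) + p * m + q) * (e1 * d + p * l + q) =
  (e1 * - (l + m) + e2 * l + e0) * (e1 * d + p * (l + m) + q) +
  (e1 * (d + m) + p * l + q) * (e1 * d + p * m + q).
Proof. by move=> -> -> ->; ring. Qed.

Let ringLML (S : comNzRingType) (d l m e1 e2 e0 p p1 q q' : S) :
  e1 = 1 -> e2 = 2%:R -> e0 = 0 -> p1 = p - e1 -> q' = - q ->
  (p1 * (d + l) + p * m + q') * (e1 * d + p * l + q) =
  (e1 * - (l + m) + p * l + q) * (p1 * d + p * (l + m) + q') +
  (e1 * (d + m) + e2 * l + e0) * (p1 * d + p * m + q').
Proof. by move=> -> -> -> -> ->; ring. Qed.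

Let ringMLL (S : comNzRingType) (d l m e1 e2 e0 p p1 q q' : S) :
  e1 = 1 -> e2 = 2%:R -> e0 = 0 -> p1 = p - e1 -> q' = - q ->
  (e1 * (d + l) + e2 * m + e0) * (p1 * d + p * l + q') =
  (p1 * - (l + m) + p * l + q') * (p1 * d + p * (l + m) + q') +
  (p1 * (d + m) + p * l + q') * (e1 * d + p * m + q).
Proof. by move=> -> -> -> -> ->; ring. Qed.

Lemma jacobi_generators x y z : jacobi x y z.
Proof.
have LL r : prodat br r genL genL =
    (1%:P%:P%:P * 'X%:P%:P + 2%:R%:P%:P%:P * r + 0%:P%:P%:P) *: cst2 genL.
  by rewrite /prodat brLL subst_lin.
have LM r : prodat br r genL genM =
    (1%:P%:P%:P * 'X%:P%:P + a%:P%:P%:P * r + b%:P%:P%:P) *: cst2 genM.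
  by rewrite /prodat brLM subst_lin.
have ML r : prodat br r genM genL =
    ((a - 1)%:P%:P%:P * 'X%:P%:P + a%:P%:P%:P * r + (- b)%:P%:P%:P) *: cst2 genM.
  by rewrite /prodat brML subst_lin.
have MM r : prodat br r genM genM = 0.
  by rewrite /prodat brMM (subst0 (@cst2B K A)).
have e1 : (1 : K)%:P%:P%:P = 1 by rewrite !rmorph1.
have e2 : (2%:R : K)%:P%:P%:P = 2%:R by rewrite !polyC_natr.
have e0 : (0 : K)%:P%:P%:P = 0.
  by apply/eqP; rewrite !polyC_eq0.
have ea : (a - 1)%:P%:P%:P = a%:P%:P%:P - 1%:P%:P%:P.
  rewrite !polyCB; reflexivity.
have eb : (- b)%:P%:P%:P = - b%:P%:P%:P.
  rewrite !polyCN; reflexivity.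
move: x; apply: jacobi_gen1; move: y; apply: jacobi_gen2;
  move: z; apply: jacobi_gen3; rewrite /jacobi.
- rewrite brLL prodatl_lin !prodatr_lin !LL.
  by apply: scaler_sum2; exact: (ringLLL _ _ _ e1 e2 e0).
- rewrite brLL brLM prodatl_lin !prodatr_lin !LM.
  by apply: scaler_sum2; exact: (ringLLM _ _ _ _ _ e1 e2 e0).
- rewrite brML brLM brLL prodatl_lin !prodatr_lin !LM !ML.
  by apply: scaler_sum2; exact: (ringLML _ _ _ e1 e2 e0 ea eb).
- rewrite brMM brLM prodatl_lin !prodatr_lin !MM (prodatr0 h).
  by rewrite !scaler0 addr0.
- rewrite brLL brML prodatl_lin !prodatr_lin !LM !ML.
  by apply: scaler_sum2; exact: (ringMLL _ _ _ e1 e2 e0 ea eb).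
- rewrite brLM brMM brML prodatl_lin !prodatr_lin !MM (prodatr0 h).
  by rewrite !scaler0 addr0.
- rewrite brML brMM prodatl0 // prodatr_lin.
  by rewrite prodatr_lin !MM !scaler0 addr0.
- by rewrite brMM !(prodatr0 h) (prodatl0 h) addr0.
Qed.
End Jacobi.

Definition genL {K : fieldType} : 'rV[{poly K}]_2 := delta_mx 0 0.
Definition genM {K : fieldType} : 'rV[{poly K}]_2 := delta_mx 0 1.

Section Wab.
Variables (K : fieldType) (a b : K).
Let A := 'rV[{poly K}]_2.

Definition W_LL : lpoly A := ('X%:P + 2%:R * 'X) *: cst genL.
Definition W_LM : lpoly A := ('X%:P + a%:P%:P * 'X + b%:P%:P) *: cst genM.
(* forced by skew-symmetry: -[L_{-λ-∂} M] *)
Definition W_ML : lpoly A := - subst (@cst _ A) (- 'X - 'X%:P) W_LM.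

Definition W_table (i j : 'I_2) : lpoly A :=
  if i == 0 then if j == 0 then W_LL else W_LM
  else if j == 0 then W_ML else 0.

Definition W_bracket := sesquilinear W_table.

Lemma W_bracketLL : W_bracket genL genL = W_LL.
Proof. exact: sesquilinear_delta. Qed.
Lemma W_bracketLM : W_bracket genL genM = W_LM.
Proof. exact: sesquilinear_delta. Qed.
Lemma W_bracketML : W_bracket genM genL = W_ML.
Proof. exact: sesquilinear_delta. Qed.
Lemma W_bracketMM : W_bracket genM genM = 0.
Proof. exact: sesquilinear_delta. Qed.

Lemma W_MLE :
  W_ML = ((a - 1)%:P%:P * 'X%:P + a%:P%:P * 'X - b%:P%:P) *: cst genM.
Proof.
rewrite /W_ML /W_LM !scalerDl !(substD (@cst_is_zmod_morphism _ A)).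
rewrite -scalerA !skewC skewE (subst_cst (@cst_is_zmod_morphism _ A)).
rewrite !scalerA -!scalerDl -scaleNr; congr (_ *: _); rewrite !polyCB; ring.
Qed.

Lemma gen_cases (i : 'I_2) : delta_mx 0 i = @genL K \/ delta_mx 0 i = @genM K.
Proof.
by case: i => [[|[|//]]] h; [left|right]; congr (delta_mx _ _); apply: val_inj.
Qed.

Lemma W_skew x y : W_bracket x y = - skewed W_bracket y x.
Proof.
have h := sesquilinear_conformal W_table; rewrite -/W_bracket in h.
have cB := @cst_is_zmod_morphism _ A.
have sD r := substD cB r.
elim/free_ind: x y => [x1 x2 IH1 IH2|c x IH|x IH||i] y.
- by rewrite (conformal_addl h) IH1 IH2 /skewed (conformal_addr h) sD opprD.
- by rewrite (conformal_scalel h) IH /skewed (conformal_scaler h) skewC scalerN.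
- rewrite (conformal_dl h) IH /skewed (conformal_dr h) scalerDl sD skewE skewC.
  by rewrite -scalerDl scalerN; congr (- (_ *: _)); ring.
- rewrite -(subrr (0 : A)) (conformalBl h) /skewed (conformalBr h) !subrr.
  by rewrite (subst0 cB) oppr0.
elim/free_ind: y => [y1 y2 IH1 IH2|c y IH|y IH||j].
- by rewrite (conformal_addr h) IH1 IH2 /skewed (conformal_addl h) sD opprD.
- by rewrite (conformal_scaler h) IH /skewed (conformal_scalel h) skewC scalerN.
- rewrite (conformal_dr h) IH /skewed (conformal_dl h) scaleNr (substN cB) skewE.
  by rewrite scalerN; congr (- _); rewrite -scaleNr; congr (_ *: _); ring.
- rewrite -(subrr (0 : A)) (conformalBr h) /skewed (conformalBl h) !subrr.
  by rewrite (subst0 cB) oppr0.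
rewrite /skewed.
case: (gen_cases i) => ->; case: (gen_cases j) => ->;
  rewrite ?W_bracketLL ?W_bracketLM ?W_bracketML ?W_bracketMM //.
- rewrite /W_LL mulr_natl mulr2n !scalerDl !sD skewC !skewE (subst_cst cB).
  by rewrite -!scalerDl -scaleNr; congr (_ *: _); ring.
- rewrite W_MLE !scalerDl !sD -!scalerA !skewC scaleNr (substN cB) !skewC skewE (subst_cst cB).
  rewrite /W_LM -!scaleNr !scalerA -!scalerDl -scaleNr; congr (_ *: _); rewrite !polyCB; ring.
by rewrite (subst0 cB) oppr0.
Qed.

Lemma W_ind (P : A -> Prop) :
    (forall x y, P x -> P y -> P (x + y)) ->
    (forall (c : K) x, P x -> P (c%:P *: x)) -> (forall x, P x -> P ('X *: x)) ->
    P genL -> P genM -> forall x, P x.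
Proof.
move=> PD PZ PX PL PM; apply: free_ind => // [|i].
  by have := PZ 0 genL PL; rewrite scale0r.
by case: (gen_cases i) => ->.
Qed.

Lemma W_lie : lie_conformal W_bracket.
Proof.
split; [exact: sesquilinear_conformal | exact: W_skew |].
apply: (@jacobi_generators K a b A genL genM W_ind W_bracket
  (sesquilinear_conformal _)).
- rewrite W_bracketLL /W_LL; congr (_ *: _).
  by rewrite !rmorph1 !rmorph0 mul1r addr0 !rmorph_nat.
- by rewrite W_bracketLM /W_LM; congr (_ *: _); rewrite !rmorph1 mul1r.
- by rewrite W_bracketML W_MLE; congr (_ *: _); rewrite !rmorphN.
- exact: W_bracketMM.
Qed.

Definition W : lieConformalAlgebra K := LieConformalAlgebra W_lie.
End Wab.

Record nc_tpca (K : fieldType) (A : lieConformalAlgebra K)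
    (m : A -> A -> lpoly A) : Prop := NcTpca {
  nc_tpca_assoc : assoc_conformal m;
  nc_tpca_compat : forall x y z,
    prodatr m 'X%:P 'X x (lca_bracket y z) *+ 2 =
      prodatl (@lca_bracket K A) ('X%:P + 'X) 'X%:P (m x y) z +
      prodatr (@lca_bracket K A) 'X 'X%:P y (m x z) }.

(* s(λ) x *)
Definition lterm (K : fieldType) (A : lmodType {poly K}) (s : {poly K}) (x : A) :
  lpoly A := s^:P *: cst x.

Definition gen_products (K : fieldType) (a b : K)
    (m : W a b -> W a b -> lpoly (W a b)) (LL LM ML MM : lpoly (W a b)) : Prop :=
  [/\ m genL genL = LL, m genL genM = LM, m genM genL = ML & m genM genM = MM].

(* Any four products of the generators come from a conformal multiplication;
   by [conformal_eq] it is unique. *)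
Lemma gen_products_exist (K : fieldType) (a b : K) (LL LM ML MM : lpoly (W a b)) :
  exists2 m, conformal m & gen_products m LL LM ML MM.
Proof.
pose t (i j : 'I_2) := if i == 0 then if j == 0 then LL else LM
                       else if j == 0 then ML else MM.
exists (sesquilinear t); first exact: sesquilinear_conformal.
split; exact: sesquilinear_delta.
Qed.

(* Main.v *)
From HB Require Import structures.
Require Import Defs.
From mathcomp Require Import all_boot all_order all_algebra.
From mathcomp Require Import reals complex ring.

(** Write x ∘_λ L = P L + Q M and x ∘_λ M = H L + N M with coefficients in
    K[∂][λ], for a fixed x.  Compatibility for (x, L, L) and (x, L, M), compared
    coordinate by coordinate, is a system of functional equations for P, Q, H, N
    in K[∂][λ][μ].  Its specialisation at μ = 0 already determines everything.
    For P and H, and for Q and N too if a = 2, each equation says that a nonzero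
    factor times a difference vanishes, for example
    (∂ + 2λ) (P(∂, λ) - P(-λ, λ)) = 0; so the coefficients do not involve ∂,
    H = 0 and N = P.  If a <> 2, substituting for ∂ the root of the factor that
    multiplies Q or N shows that Q(-λ, λ) and P(-λ, λ) vanish, and then x
    annihilates both generators ([compat_products]).  If a = 2, every choice of
    f, g in K[λ] with x ∘_λ L = f L + g M and x ∘_λ M = f M satisfies the
    compatibility equations ([compat_of_products]).

    A compatible product for a = 2 is thus given by four polynomials: f, g for
    x = L and p, q for x = M.  In other words each generator acts as an element
    F_L = f + gε or F_M = p + qε of K[ε][λ], with ε² = 0 and ε L = M, and
    associativity reads, for x = L and x = M,
      F_L(μ) F_x(λ) = f_x(λ) F_L(λ+μ) + g_x(λ) F_M(λ+μ),
      F_M(μ) F_x(λ) = f_x(λ) F_M(λ+μ)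
    ([assoc_generators]).  Two specialisations suffice to solve this: μ = 0, and
    μ = λ, which turns an additivity condition into h(2λ) = 2 h(λ), that is,
    h linear in characteristic 0 ([double_linear]).  Whether p = 0, then whether
    q = 0, and then whether f = 0, separates the four families
    ([assoc_equations_solved]).

    Both identities extend from the generators to the whole module because all
    their terms are additive in each of the three arguments and obey the same
    scaling laws under ∂ ([sesquitrilinear_eq]). *)

Set Implicit Arguments.
Unset Strict Implicit.
Unset Printing Implicit Defensive.

Import GRing.Theory.
Local Open Scope ring_scope.

(** * Substitution for the variables of a polynomial *)

Section HornerAt.
Variables (R : nzSemiRingType) (T : comNzRingType).
Variables (phi : {rmorphism R -> T}) (v : T).

(** Iterating this on [{poly {poly K}}] substitutes for both variables at once,
    which is how every substitution below is expressed. *)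
Definition horner_at (p : {poly R}) : T := (map_poly phi p).[v].

HB.instance Definition _ :=
  GRing.RMorphism.copy horner_at (horner_eval v \o map_poly phi).

Lemma horner_atC c : horner_at c%:P = phi c.
Proof. by rewrite /horner_at map_polyC hornerC. Qed.

Lemma horner_atX : horner_at 'X = v.
Proof. by rewrite /horner_at map_polyX hornerX. Qed.

Lemma horner_at0 : horner_at 0 = 0. Proof. exact: rmorph0. Qed.

Lemma horner_atD p q : horner_at (p + q) = horner_at p + horner_at q.
Proof. exact: rmorphD. Qed.

Lemma horner_atM p q : horner_at (p * q) = horner_at p * horner_at q.
Proof. exact: rmorphM. Qed.

Definition horner_atE :=
  (horner_atC, horner_atX, horner_at0, horner_atD, horner_atM).
End HornerAt.

Lemma horner_at_id (R : comNzRingType) (p : {poly R}) :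
  horner_at polyC 'X p = p.
Proof.
elim/poly_ind: p => [|p c IH]; first by rewrite horner_at0.
by rewrite !horner_atE IH.
Qed.

Lemma horner_at_polyC0 (R : comNzRingType) (p : {poly R}) :
  horner_at polyC 0 p = p.[0]%:P.
Proof.
elim/poly_ind: p => [|p c IH]; first by rewrite horner_at0 horner0.
by rewrite !horner_atE hornerD hornerC hornerM hornerX !mulr0 !add0r.
Qed.

Section SubstScale.
Variables (R : nzRingType) (S : comNzRingType).
Variables (V : lmodType R) (W : lmodType S).
Variables (phi : {rmorphism R -> S}) (f : V -> W).
Hypothesis fB : {morph f : x y / x - y}.
Hypothesis fZ : forall c v, f (c *: v) = phi c *: f v.

(** Reduces products of polynomial multiples of the generators to substitutions
    in the scalars. *)
Lemma substZ r (p : {poly R}) w :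
  subst f r (p *: w) = horner_at phi r p *: subst f r w.
Proof.
elim/poly_ind: p => [|p c IH]; first by rewrite rmorph0 !scale0r (subst0 fB).
rewrite scalerDl (substD fB) commr_polyX -scalerA (substZX fB) IH.
rewrite (substZC fB (d := phi c)) // scalerA -scalerDl.
by rewrite rmorphD rmorphM /= horner_atC horner_atX [r * _]mulrC.
Qed.
End SubstScale.

Definition cst3 {K : fieldType} (c : K) : {poly {poly {poly K}}} := c%:P%:P%:P.
HB.instance Definition _ (K : fieldType) :=
  GRing.RMorphism.copy (@cst3 K) (polyC \o (polyC \o polyC)).

Section Cst3.
Variable K : fieldType.
Local Notation S3 := {poly {poly {poly K}}}.

Lemma cst3B1 (c : K) : cst3 (c - 1) = cst3 c - 1.
Proof. by rewrite (@rmorphB K S3 cst3) (@rmorph1 K S3 cst3). Qed.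

Lemma cst3_2 : cst3 (2%:R : K) = 1 *+ 2.
Proof. exact: (@rmorph_nat K S3 cst3). Qed.
End Cst3.

Section Ev.
Variables (K : fieldType) (u v : {poly {poly {poly K}}}).

(** p(u), for p in K[∂] or in K[λ], as an element of K[∂][λ][μ]. *)
Definition ev1 : {poly K} -> {poly {poly {poly K}}} :=
  @horner_at K {poly {poly {poly K}}} cst3 u.
HB.instance Definition _ :=
  GRing.RMorphism.copy ev1 (@horner_at K {poly {poly {poly K}}} cst3 u).

(** P(u, v), for P(∂, λ) in K[∂][λ], as an element of K[∂][λ][μ]. *)
Definition ev2 : {poly {poly K}} -> {poly {poly {poly K}}} :=
  @horner_at {poly K} {poly {poly {poly K}}} ev1 v.
HB.instance Definition _ :=
  GRing.RMorphism.copy ev2 (@horner_at {poly K} {poly {poly {poly K}}} ev1 v).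

Lemma ev1C c : ev1 c%:P = cst3 c. Proof. exact: horner_atC. Qed.
Lemma ev1X : ev1 'X = u. Proof. exact: horner_atX. Qed.
Lemma ev2C p : ev2 p%:P = ev1 p. Proof. exact: horner_atC. Qed.
Lemma ev2X : ev2 'X = v. Proof. exact: horner_atX. Qed.
Lemma ev10 : ev1 0 = 0. Proof. exact: rmorph0. Qed.
Lemma ev1N p : ev1 (- p) = - ev1 p. Proof. exact: rmorphN. Qed.
Lemma ev1D p q : ev1 (p + q) = ev1 p + ev1 q. Proof. exact: rmorphD. Qed.
Lemma ev1M p q : ev1 (p * q) = ev1 p * ev1 q. Proof. exact: rmorphM. Qed.
Lemma ev20 : ev2 0 = 0. Proof. exact: rmorph0. Qed.
Lemma ev2N p : ev2 (- p) = - ev2 p. Proof. exact: rmorphN. Qed.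
Lemma ev2D p q : ev2 (p + q) = ev2 p + ev2 q. Proof. exact: rmorphD. Qed.
Lemma ev2M p q : ev2 (p * q) = ev2 p * ev2 q. Proof. exact: rmorphM. Qed.
Definition evE :=
  (ev1C, ev1X, ev10, ev1N, ev1D, ev1M, ev2C, ev2X, ev20, ev2N, ev2D, ev2M).
End Ev.

Lemma ev1_partial (K : fieldType) (p : {poly K}) : ev1 'X%:P%:P p = p%:P%:P.
Proof.
elim/poly_ind: p => [|p c IH]; first by rewrite !rmorph0.
by rewrite !evE IH !polyCD !polyCM.
Qed.

Lemma ev2_const (K : fieldType) u v (p : {poly K}) : ev2 u v p^:P = ev1 v p.
Proof.
elim/poly_ind: p => [|p c IH]; first by rewrite !rmorph0.
by rewrite rmorphD rmorphM /= map_polyC map_polyX !evE IH.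
Qed.

Section Specialise.
Variables (K : fieldType) (T : comNzRingType) (iota : {rmorphism K -> T}).

Section At2.
Variables (u v : T).

(** P(u, v), for P(∂, λ) in K[∂][λ] and u, v in an arbitrary K-algebra. *)
Definition at2 : {poly {poly K}} -> T := horner_at (horner_at iota u) v.
HB.instance Definition _ :=
  GRing.RMorphism.copy at2 (horner_at (horner_at iota u) v).

Lemma at2X : at2 'X = v. Proof. exact: horner_atX. Qed.
Lemma at2C p : at2 p%:P = horner_at iota u p. Proof. exact: horner_atC. Qed.
Lemma at20 : at2 0 = 0. Proof. exact: rmorph0. Qed.
Lemma at2D p q : at2 (p + q) = at2 p + at2 q. Proof. exact: rmorphD. Qed.
Lemma at2M p q : at2 (p * q) = at2 p * at2 q. Proof. exact: rmorphM. Qed.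
Definition at2E := (at2X, at2C, at20, at2D, at2M).
End At2.

Section At3.
Variables (u v w : T).

(** The specialisation ∂ = u, λ = v, μ = w of an identity in K[∂][λ][μ]. *)
Definition at3 : {poly {poly {poly K}}} -> T := horner_at (at2 u v) w.
HB.instance Definition _ := GRing.RMorphism.copy at3 (horner_at (at2 u v) w).

Lemma at3X : at3 'X = w. Proof. exact: horner_atX. Qed.
Lemma at3_polyC P : at3 P%:P = at2 u v P. Proof. exact: horner_atC. Qed.
Lemma at3Y : at3 'X%:P = v. Proof. by rewrite at3_polyC at2X. Qed.
Lemma at3Z : at3 'X%:P%:P = u.
Proof. by rewrite at3_polyC at2C horner_atX. Qed.
Lemma at3C c : at3 (cst3 c) = iota c.
Proof. by rewrite /cst3 at3_polyC at2C horner_atC. Qed.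
Lemma at30 : at3 0 = 0. Proof. exact: rmorph0. Qed.
Lemma at3N p : at3 (- p) = - at3 p. Proof. exact: rmorphN. Qed.
Lemma at3D p q : at3 (p + q) = at3 p + at3 q. Proof. exact: rmorphD. Qed.
Lemma at3M p q : at3 (p * q) = at3 p * at3 q. Proof. exact: rmorphM. Qed.

Lemma at3_ev1 r p : at3 (ev1 r p) = horner_at iota (at3 r) p.
Proof.
elim/poly_ind: p => [|p c IH]; first by rewrite ev10 at30 rmorph0.
by rewrite !evE at3D at3M at3C IH !horner_atE.
Qed.

Lemma at3_ev2 r s P : at3 (ev2 r s P) = at2 (at3 r) (at3 s) P.
Proof.
elim/poly_ind: P => [|P c IH]; first by rewrite ev20 at30 at20.
by rewrite !evE at3D at3M at3_ev1 IH !at2E.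
Qed.
End At3.
End Specialise.

Section Poly2.
Variables (K : fieldType).
Notation cc := (polyC \o polyC : {rmorphism K -> {poly {poly K}}}).

(** P(∂, λ) is the value of P at the generic point, so an identity proved in
    all specialisations can be read off in K[∂][λ] itself. *)
Lemma at2_id (P : {poly {poly K}}) : at2 cc 'X%:P 'X P = P.
Proof.
elim/poly_ind: P => [|P p IH]; first by rewrite at20.
rewrite !at2E IH; congr (_ + _).
elim/poly_ind: p => [|p c {}IH]; first by rewrite horner_at0.
by rewrite !horner_atE IH polyCD polyCM.
Qed.

(** P(-λ, λ) does not involve ∂: it lies in the subring K[λ] of K[∂][λ]. *)
Lemma at2_diag (P : {poly {poly K}}) :
  at2 cc (- 'X) 'X P = (at2 polyC (- 'X) 'X P)^:P.
Proof.
elim/poly_ind: P => [|P p IH]; first by rewrite !at20 rmorph0.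
rewrite !at2E IH rmorphD rmorphM /= map_polyX; congr (_ + _).
elim/poly_ind: p => [|p c {}IH]; first by rewrite !horner_at0 rmorph0.
by rewrite !horner_atE IH rmorphD rmorphM rmorphN /= map_polyX map_polyC.
Qed.
End Poly2.

(** * Scaling laws and extension from the generators *)

Section Scaling.
Variables (K : fieldType) (A : lmodType {poly K}).
Variables (m : A -> A -> lpoly A) (mC : conformal m).
Implicit Types (p : {poly K}) (P : {poly {poly K}}) (x y z : A) (w : lpoly A).
Implicit Types (r s : {poly {poly {poly K}}}).

Notation cc := (polyC \o polyC : K -> {poly {poly K}}).

Lemma conformalZl p x y : m (p *: x) y = horner_at cc (- 'X) p *: m x y.
Proof.
elim/poly_ind: p => [|p c IH].
  by rewrite rmorph0 !scale0r -(subrr (0 : A)) (conformalBl mC) subrr.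
rewrite scalerDl (conformal_addl mC) mulrC -scalerA (conformal_dl mC) IH.
rewrite (conformal_scalel mC) scalerA -scalerDl.
by rewrite rmorphD rmorphM /= horner_atC horner_atX.
Qed.

Lemma conformalZr p x y : m x (p *: y) = horner_at cc ('X%:P + 'X) p *: m x y.
Proof.
elim/poly_ind: p => [|p c IH].
  by rewrite rmorph0 !scale0r -(subrr (0 : A)) (conformalBr mC) subrr.
rewrite scalerDl (conformal_addr mC) mulrC -scalerA (conformal_dr mC) IH.
rewrite (conformal_scaler mC) scalerA -scalerDl.
by rewrite rmorphD rmorphM /= horner_atC horner_atX.
Qed.

Lemma subst_cst2Z r P w :
  subst (@cst2 K A) r (P *: w) =
  ev2 'X%:P%:P r P *: subst (@cst2 K A) r w.
Proof. by apply: (substZ (@cst2B K A)) => p x; rewrite cst2Z -ev1_partial. Qed.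

Lemma ev2_horner_at r s q p :
  ev2 r s (horner_at cc q p) = ev1 (ev2 r s q) p.
Proof.
elim/poly_ind: p => [|p c IH]; first by rewrite !rmorph0.
rewrite [horner_at _ _ _]rmorphD rmorphM /= horner_atC horner_atX.
by rewrite !evE IH.
Qed.

Lemma prodat_scalel r p x y :
  prodat m r (p *: x) y = ev1 (- r) p *: prodat m r x y.
Proof. by rewrite /prodat conformalZl subst_cst2Z ev2_horner_at !evE. Qed.

Lemma prodat_scaler r p x y :
  prodat m r x (p *: y) = ev1 ('X%:P%:P + r) p *: prodat m r x y.
Proof. by rewrite /prodat conformalZr subst_cst2Z ev2_horner_at !evE. Qed.

Lemma prodatr_scalel r s p x w :
  prodatr m r s (p *: x) w = ev1 (- r) p *: prodatr m r s x w.
Proof.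
rewrite /prodatr /subst scaler_sumr; apply: eq_bigr => n _.
by rewrite prodat_scalel !scalerA mulrC.
Qed.

Lemma prodatr_scaler r s P x w :
  prodatr m r s x (P *: w) = ev2 ('X%:P%:P + r) s P *: prodatr m r s x w.
Proof. by apply: (substZ (prodatBr mC r x)) => p y; rewrite prodat_scaler. Qed.

Lemma prodatl_scalel r s P w z :
  prodatl m r s (P *: w) z = ev2 (- r) s P *: prodatl m r s w z.
Proof. by apply: (substZ (prodatBl mC r z)) => p x; rewrite prodat_scalel. Qed.

Lemma prodatl_scaler r s p w z :
  prodatl m r s w (p *: z) = ev1 ('X%:P%:P + r) p *: prodatl m r s w z.
Proof.
rewrite /prodatl /subst scaler_sumr; apply: eq_bigr => n _.
by rewrite prodat_scaler !scalerA mulrC.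
Qed.
End Scaling.

Section Trilinear.
Variables (K : fieldType) (A : lmodType {poly K}).
Implicit Types (F : A -> A -> A -> lpoly (lpoly A)) (x y z : A).
Notation d := ('X%:P%:P : {poly {poly {poly K}}}).
Notation la := ('X%:P : {poly {poly {poly K}}}).
Notation mu := ('X : {poly {poly {poly K}}}).

(** The behaviour shared by all the terms of the associativity and of the
    compatibility identity: ∂ acts as -λ in the first argument, as -μ in the
    second and as ∂ + λ + μ in the third. *)
Record sesquitrilinear F : Prop := Sesquitrilinear {
  tri_add1 : forall x1 x2 y z, F (x1 + x2) y z = F x1 y z + F x2 y z;
  tri_add2 : forall x y1 y2 z, F x (y1 + y2) z = F x y1 z + F x y2 z;
  tri_add3 : forall x y z1 z2, F x y (z1 + z2) = F x y z1 + F x y z2;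
  tri_scale1 : forall p x y z, F (p *: x) y z = ev1 (- la) p *: F x y z;
  tri_scale2 : forall p x y z, F x (p *: y) z = ev1 (- mu) p *: F x y z;
  tri_scale3 : forall p x y z,
    F x y (p *: z) = ev1 (d + la + mu) p *: F x y z }.

Lemma sesquitrilinearD F G : sesquitrilinear F -> sesquitrilinear G ->
  sesquitrilinear (fun x y z => F x y z + G x y z).
Proof.
move=> [F1 F2 F3 F4 F5 F6] [G1 G2 G3 G4 G5 G6]; split=> *.
- by rewrite F1 G1 addrACA.
- by rewrite F2 G2 addrACA.
- by rewrite F3 G3 addrACA.
- by rewrite F4 G4 scalerDr.
- by rewrite F5 G5 scalerDr.
- by rewrite F6 G6 scalerDr.
Qed.

Variables (u v : A).
Hypothesis span_uv : forall x, exists p q, x = p *: u + q *: v.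

(** Reduces both identities to the generators: each argument p u + q v is
    expanded in turn, and p and q come out as the same scalars on both sides. *)
Lemma sesquitrilinear_eq F G : sesquitrilinear F -> sesquitrilinear G ->
  (forall x y z, x \in [:: u; v] -> y \in [:: u; v] -> z \in [:: u; v] ->
     F x y z = G x y z) ->
  forall x y z, F x y z = G x y z.
Proof.
move=> [F1 F2 F3 F4 F5 F6] [G1 G2 G3 G4 G5 G6] FG x y z.
have [uuv vuv] : u \in [:: u; v] /\ v \in [:: u; v] by rewrite !inE !eqxx orbT.
have {}FG x1 y1 : x1 \in [:: u; v] -> y1 \in [:: u; v] -> F x1 y1 z = G x1 y1 z.
  have [p [q ->]] := span_uv z => xuv yuv.
  by rewrite F3 G3 !F6 !G6 !FG.
have {}FG x1 : x1 \in [:: u; v] -> F x1 y z = G x1 y z.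
  have [p [q ->]] := span_uv y => xuv.
  by rewrite F2 G2 !F5 !G5 !FG.
by have [p [q ->]] := span_uv x; rewrite F1 G1 !F4 !G4 !FG.
Qed.

Variables (m1 m2 : A -> A -> lpoly A).
Hypotheses (m1C : conformal m1) (m2C : conformal m2).

Lemma sesquitrilinear_prodatr :
  sesquitrilinear (fun x y z => prodatr m1 la mu x (m2 y z)).
Proof.
split=> *.
- exact: prodatrDl.
- by rewrite (conformal_addl m2C) prodatrDr.
- by rewrite (conformal_addr m2C) prodatrDr.
- by rewrite prodatr_scalel.
- by rewrite (conformalZl m2C) prodatr_scaler // ev2_horner_at !evE.
- by rewrite (conformalZr m2C) prodatr_scaler // ev2_horner_at !evE.
Qed.

Lemma sesquitrilinear_prodatr_swap :
  sesquitrilinear (fun x y z => prodatr m1 mu la y (m2 x z)).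
Proof.
split=> *.
- by rewrite (conformal_addl m2C) prodatrDr.
- exact: prodatrDl.
- by rewrite (conformal_addr m2C) prodatrDr.
- by rewrite (conformalZl m2C) prodatr_scaler // ev2_horner_at !evE.
- by rewrite prodatr_scalel.
- by rewrite (conformalZr m2C) prodatr_scaler // ev2_horner_at !evE addrAC.
Qed.

Lemma sesquitrilinear_prodatl :
  sesquitrilinear (fun x y z => prodatl m1 (la + mu) la (m2 x y) z).
Proof.
split=> *.
- by rewrite (conformal_addl m2C) prodatlDl.
- by rewrite (conformal_addr m2C) prodatlDl.
- exact: prodatlDr.
- by rewrite (conformalZl m2C) prodatl_scalel // ev2_horner_at !evE.
- rewrite (conformalZr m2C) prodatl_scalel // ev2_horner_at !evE.
  by rewrite opprD addrAC addNr add0r.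
- by rewrite prodatl_scaler // addrA.
Qed.
End Trilinear.

(** * Coordinates in a free module of rank two *)

Section Basis.
Variables (R : nzRingType) (V : lmodType R).
Implicit Types (u v : V) (p q : R).

Definition comb u v p q := p *: u + q *: v.

Record basis2 u v : Prop := Basis2 {
  basis2_span : forall x, exists p q, x = comb u v p q;
  basis2_inj : forall p q p' q',
    comb u v p q = comb u v p' q' -> p = p' /\ q = q' }.

Lemma combD u v p q p' q' :
  comb u v p q + comb u v p' q' = comb u v (p + p') (q + q').
Proof. by rewrite /comb addrACA -!scalerDl. Qed.

Lemma combZ u v c p q : c *: comb u v p q = comb u v (c * p) (c * q).
Proof. by rewrite /comb scalerDr !scalerA. Qed.

Lemma comb0 u v : comb u v 0 0 = 0. Proof. by rewrite /comb !scale0r addr0. Qed.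
Lemma combR u v q : q *: v = comb u v 0 q.
Proof. by rewrite /comb scale0r add0r. Qed.

Lemma basis2_eq u v (uv : basis2 u v) p q p' q' :
  comb u v p q = comb u v p' q' <-> p = p' /\ q = q'.
Proof. by split=> [/(basis2_inj uv)|[-> ->]]. Qed.
End Basis.

Section BasisCst.
Variables (R : nzRingType) (V : lmodType R).
Implicit Types (u v : V).

Lemma lcoef_scale_cst (P : {poly R}) u k : lcoef k (P *: cst u) = P`_k *: u.
Proof.
rewrite [LHS]lcoef_scale big_ord_recr /= subnn lcoef_cst eqxx.
rewrite big1 ?add0r // => i _.
by rewrite lcoef_cst subn_eq0 leqNgt ltn_ord scaler0.
Qed.

(** Extending scalars from R to R[X] preserves bases; iterated, this gives
    coordinates in A[λ] and in A[λ][μ]. *)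
Lemma basis2_cst u v : basis2 u v -> basis2 (cst u) (cst v).
Proof.
move=> [span inj]; split=> [w|P Q P' Q' e]; last first.
  suff e' k : P`_k = P'`_k /\ Q`_k = Q'`_k.
    by split; apply/polyP => k; case: (e' k).
  apply: inj; move/(congr1 (lcoef k)): e.
  by rewrite /comb !raddfD /= !lcoef_scale_cst.
suff -> : w = \sum_(k < lsize w) 'X^k *: cst (lcoef k w).
  elim/big_rec: _ => [|k _ _ [P [Q ->]]]; first by exists 0, 0; rewrite comb0.
  have [p [q ->]] := span (lcoef k w).
  exists ('X^k * p%:P + P), ('X^k * q%:P + Q).
  rewrite -combD; congr (_ + _).
  by rewrite /comb raddfD /= !cstZ scalerDr !scalerA.
apply/lpolyP => n; rewrite raddf_sum /=.
under eq_bigr do rewrite lcoef_scale_cst coefXn.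
have [lt_n|le_n] := ltnP n (lsize w).
  rewrite (bigD1 (Ordinal lt_n)) //= eqxx scale1r big1 ?addr0 // => k /negPf.
  by rewrite -val_eqE /= eq_sym => ->; rewrite scale0r.
rewrite lcoef_default // big1 // => k _.
by rewrite gtn_eqF ?scale0r // (leq_trans (ltn_ord k)).
Qed.
End BasisCst.

Lemma basis2_gen (K : fieldType) : basis2 (@genL K) genM.
Proof.
have gE p q : comb genL genM p q =
    \row_i (if i == 0 then p else q) :> 'rV[{poly K}]_2.
  apply/rowP => i; rewrite !mxE.
  by case: i => [[|[|//]] lt_i]; rewrite /= ?(mulr1, mulr0, addr0, add0r).
split=> [x|p q p' q'].
  exists (x 0 0), (x 0 1); rewrite gE; apply/rowP => i; rewrite mxE.
  by case: i => [[|[|//]] lt_i]; congr (x _ _); apply: val_inj.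
rewrite !gE => /rowP e; split.
  by have := e 0; rewrite !mxE.
by have := e 1; rewrite !mxE.
Qed.

Section Coordinates.
Variables (K : fieldType) (A : lmodType {poly K}) (L M : A).
Variables (m : A -> A -> lpoly A) (mC : conformal m).
Implicit Types (r s : {poly {poly {poly K}}}) (P Q : {poly {poly K}}).
Notation d := ('X%:P%:P : {poly {poly {poly K}}}).

Lemma prodat_scale_cst r x y z P : m x y = P *: cst z ->
  prodat m r x y = ev2 d r P *: cst2 z.
Proof.
by move=> e; rewrite /prodat e subst_cst2Z (subst_cst (@cst2B K A)).
Qed.

Lemma prodat_comb r x y P Q : m x y = comb (cst L) (cst M) P Q ->
  prodat m r x y = comb (cst2 L) (cst2 M) (ev2 d r P) (ev2 d r Q).
Proof.
move=> e; rewrite /prodat e /comb (substD (@cst2B K A)) !subst_cst2Z.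
by rewrite !(subst_cst (@cst2B K A)).
Qed.

Lemma prodatr_scale_cst r s x y P :
  prodatr m r s x (P *: cst y) = ev2 (d + r) s P *: prodat m r x y.
Proof. by rewrite (prodatr_scaler mC) (prodatr_cst mC). Qed.

Lemma prodatr_comb r s x P Q :
  prodatr m r s x (comb (cst L) (cst M) P Q) =
  ev2 (d + r) s P *: prodat m r x L + ev2 (d + r) s Q *: prodat m r x M.
Proof. by rewrite /comb (prodatrDr mC) !prodatr_scale_cst. Qed.

Lemma prodatl_comb r s P Q z :
  prodatl m r s (comb (cst L) (cst M) P Q) z =
  ev2 (- r) s P *: prodat m r L z + ev2 (- r) s Q *: prodat m r M z.
Proof.
by rewrite /comb (prodatlDl mC) !(prodatl_scalel mC) !(prodatl_cst mC).
Qed.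
End Coordinates.

(** * Compatibility on the generators *)

(** The following lemmas compare coordinates in the compatibility identity for
    (x, L, L), (x, L, M), (x, M, L) and (x, M, M).  The left-hand side is a
    multiple of x ∘ L or x ∘ M; on the right, each term is a combination of two
    brackets, and every bracket is a multiple of a single generator. *)
Section FreeCompat.
Variables (S : nzRingType) (V : lmodType S) (u v : V).
Hypothesis uv_basis : basis2 u v.
Implicit Types p q c : S.

Let sumE p1 q1 p2 q2 : (p1 *: u + q1 *: v) + (p2 *: u + q2 *: v) =
  comb u v (p1 + p2) (q1 + q2).
Proof. exact: combD. Qed.

Lemma free_compatLL c p q p1 q1 p2 q2 c1 c2 c3 c4 :
  (c *: comb u v p q) *+ 2 =
    (p1 *: (c1 *: u) + q1 *: (c2 *: v)) + (p2 *: (c3 *: u) + q2 *: (c4 *: v))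
  <-> (c * p) *+ 2 = p1 * c1 + p2 * c3 /\ (c * q) *+ 2 = q1 * c2 + q2 * c4.
Proof.
by rewrite combZ mulr2n combD !scalerA sumE (basis2_eq uv_basis) -!mulr2n.
Qed.

Lemma free_compatLM c p q p1 q1 p2 q2 c1 c3 c4 :
  (c *: comb u v p q) *+ 2 =
    (p1 *: (c1 *: v) + q1 *: 0) + (p2 *: (c3 *: u) + q2 *: (c4 *: v))
  <-> (c * p) *+ 2 = p2 * c3 /\ (c * q) *+ 2 = p1 * c1 + q2 * c4.
Proof.
rewrite combZ mulr2n combD !scalerA scaler0 addr0 (combR u) -/(comb u v _ _).
by rewrite combD (basis2_eq uv_basis) add0r -!mulr2n.
Qed.

Lemma free_compatML c p q p1 q1 p2 q2 c1 c2 c3 :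
  (c *: comb u v p q) *+ 2 =
    (p1 *: (c1 *: u) + q1 *: (c2 *: v)) + (p2 *: (c3 *: v) + q2 *: 0)
  <-> (c * p) *+ 2 = p1 * c1 /\ (c * q) *+ 2 = q1 * c2 + p2 * c3.
Proof.
rewrite combZ mulr2n combD !scalerA scaler0 addr0 -/(comb u v _ _).
by rewrite (combR u v (p2 * c3)) combD (basis2_eq uv_basis) addr0 -!mulr2n.
Qed.

Lemma free_compatMM p1 q1 p2 q2 c1 c2 :
  0 *+ 2 =
    (p1 *: (c1 *: v) + q1 *: 0) + (p2 *: (c2 *: v) + q2 *: 0)
  <-> 0 = p1 * c1 + p2 * c2.
Proof.
rewrite mul0rn !scaler0 !addr0 !scalerA -scalerDl -(comb0 u v) (combR u v).
by rewrite (basis2_eq uv_basis); split=> [[]|->].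
Qed.
End FreeCompat.

(** Transport of the coordinate equations along a ring morphism.  They are
    stated over abstract rings, with the image of each value given separately,
    to be applied to the evaluation of K[∂][λ][μ] at a point. *)
Section RmorphEquations.
Variables (S : nzRingType) (T : comNzRingType) (e : {rmorphism S -> T}).
Variables (a b c d l m p q r : S) (a' b' c' d' l' m' p' q' r' : T).
Hypotheses (ea : e a = a') (eb : e b = b') (ec : e c = c').
Hypotheses (ed : e d = d') (el : e l = l') (em : e m = m').
Hypotheses (ep : e p = p') (eq : e q = q') (er : e r = r').

Lemma rmorph_LL_coordL :
  ((d + l + m + m) * p) *+ 2 =
    q * (d + (l + m) + (l + m)) + r * (d + m + m) ->
  ((d' + l' + m' + m') * p') *+ 2 =
    q' * (d' + (l' + m') + (l' + m')) + r' * (d' + m' + m').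
Proof.
rewrite -ed -el -em -ep -eq -er => h.
by rewrite -!(rmorphD, rmorphM, rmorphMn) /= h.
Qed.

Lemma rmorph_LL_coordM :
  ((d + l + m + m) * p) *+ 2 =
    q * (c * d + a * (l + m) - b) + r * (d + a * m + b) ->
  ((d' + l' + m' + m') * p') *+ 2 =
    q' * (c' * d' + a' * (l' + m') - b') + r' * (d' + a' * m' + b').
Proof.
rewrite -ea -eb -ec -ed -el -em -ep -eq -er => h.
by rewrite -rmorphN -!(rmorphD, rmorphM, rmorphMn) /= h.
Qed.

Lemma rmorph_LM_coordL :
  ((d + l + a * m + b) * p) *+ 2 = q * (d + m + m) ->
  ((d' + l' + a' * m' + b') * p') *+ 2 = q' * (d' + m' + m').
Proof.
rewrite -ea -eb -ed -el -em -ep -eq => h.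
by rewrite -!(rmorphD, rmorphM, rmorphMn) /= h.
Qed.

Lemma rmorph_LM_coordM :
  ((d + l + a * m + b) * p) *+ 2 =
    q * (d + a * (l + m) + b) + r * (d + a * m + b) ->
  ((d' + l' + a' * m' + b') * p') *+ 2 =
    q' * (d' + a' * (l' + m') + b') + r' * (d' + a' * m' + b').
Proof.
rewrite -ea -eb -ed -el -em -ep -eq -er => h.
by rewrite -!(rmorphD, rmorphM, rmorphMn) /= h.
Qed.
End RmorphEquations.

(** The way in which every equation below is solved for P: it remains to check a
    ring identity, in which the equation itself provides x = y. *)
Lemma cancel_factor (T : idomainType) (c P Q x y : T) :
  c != 0 -> x = y -> c * (P - Q) = x - y -> P = Q.
Proof.
move=> c0 -> /eqP; rewrite subrr mulf_eq0 (negPf c0) /= subr_eq0 => /eqP.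
exact.
Qed.

(** The equations at ∂ = u, λ = v, μ = 0, with P0 and Q0 for the values of P
    and Q at (-λ, λ).  In the two lemmas for a = 2, that value is written
    1 *+ 2. *)
Section CompatAlgebra.
Variables (T : idomainType).
Implicit Types u v a b P Q : T.

Lemma solve_LL_coordL u v P P0 : u + v *+ 2 != 0 ->
  ((u + v) * P) *+ 2 = P0 * (u + v + v) + P * u -> P = P0.
Proof. by move=> n0 e; apply: (cancel_factor n0 e); ring. Qed.

Lemma solve_LL_coordM u v Q Q0 b : u + v *+ 2 - b != 0 ->
  ((u + v) * Q) *+ 2 =
    Q0 * ((1 *+ 2 - 1) * u + 1 *+ 2 * v - b) + Q * (u + b) -> Q = Q0.
Proof. by move=> n0 e; apply: (cancel_factor n0 e); ring. Qed.

Lemma solve_LL_coordM_zero u v Q b c : u + v *+ 2 - b != 0 ->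
  ((u + v) * Q) *+ 2 = 0 * c + Q * (u + b) -> Q = 0.
Proof. by move=> n0 e; apply: (cancel_factor n0 e); ring. Qed.

Lemma solve_LM_coordL u v H b : u + (v + b) *+ 2 != 0 ->
  ((u + v + b) * H) *+ 2 = H * u -> H = 0.
Proof. by move=> n0 e; apply: (cancel_factor n0 e); ring. Qed.

Lemma solve_LM_coordM u v N P0 b : u + v *+ 2 + b != 0 ->
  ((u + v + b) * N) *+ 2 =
    P0 * (u + 1 *+ 2 * v + b) + N * (u + b) -> N = P0.
Proof. by move=> n0 e; apply: (cancel_factor n0 e); ring. Qed.

Lemma solve_LM_coordM_zero u v N b c : u + v *+ 2 + b != 0 ->
  ((u + v + b) * N) *+ 2 = 0 * c + N * (u + b) -> N = 0.
Proof. by move=> n0 e; apply: (cancel_factor n0 e); ring. Qed.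

(** Here u = b - 2v is the root of the factor u + 2v - b, so that Q disappears
    from the equation and only Q0 remains. *)
Lemma solve_LL_diag v Q Q0 a b : (1 *+ 2 - a) * (v - b) != 0 ->
  ((b - v *+ 2 + v) * Q) *+ 2 =
    Q0 * ((a - 1) * (b - v *+ 2) + a * v - b) + Q * (b - v *+ 2 + b) -> Q0 = 0.
Proof. by move=> n0 e; apply: (cancel_factor n0 (esym e)); ring. Qed.

(** Likewise, u = -b - 2v is the root of u + 2v + b. *)
Lemma solve_LM_diag v N P0 a b : (1 *+ 2 - a) * v != 0 ->
  ((- b - v *+ 2 + v + b) * N) *+ 2 =
    P0 * (- b - v *+ 2 + a * v + b) + N * (- b - v *+ 2 + b) -> P0 = 0.
Proof. by move=> n0 e; apply: (cancel_factor n0 e); ring. Qed.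
End CompatAlgebra.

(** The coordinate equations hold for x ∘ L = f L + g M and x ∘ M = f M when
    a = 2, and trivially when f = g = 0. *)
Section CheckCompat.
Variables (T : comNzRingType) (d l m a b f g : T).

Lemma verify_LL : a = 1 *+ 2 \/ f = 0 /\ g = 0 ->
  ((d + l + m + m) * f) *+ 2 =
    f * (d + (l + m) + (l + m)) + f * (d + m + m) /\
  ((d + l + m + m) * g) *+ 2 =
    g * ((a - 1) * d + a * (l + m) - b) + g * (d + a * m + b).
Proof. by case=> [->|[-> ->]]; split; ring. Qed.

Lemma verify_LM : a = 1 *+ 2 \/ f = 0 /\ g = 0 ->
  ((d + l + a * m + b) * 0) *+ 2 = 0 * (d + m + m) /\
  ((d + l + a * m + b) * f) *+ 2 =
    f * (d + a * (l + m) + b) + f * (d + a * m + b).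
Proof. by case=> [->|[-> _]]; split; ring. Qed.

Lemma verify_ML : a = 1 *+ 2 \/ f = 0 /\ g = 0 ->
  (((a - 1) * (d + l) + a * m - b) * 0) *+ 2 =
    0 * (d + (l + m) + (l + m)) /\
  (((a - 1) * (d + l) + a * m - b) * f) *+ 2 =
    f * ((a - 1) * d + a * (l + m) - b) + f * ((a - 1) * d + a * m - b).
Proof. by case=> [->|[-> _]]; split; ring. Qed.

Lemma verify_MM : 0 = 0 * f + 0 * g.
Proof. by rewrite !mul0r addr0. Qed.
End CheckCompat.

(** The bracket of W(a, b) on two elements L, M of an arbitrary K[∂]-module.
    The classification rests on these four values and on L, M being a basis. *)
Record W_products (K : fieldType) (a b : K) (A : lmodType {poly K}) (L M : A)
    (br : A -> A -> lpoly A) : Prop := WProducts {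
  W_products_LL : br L L = ('X%:P + 'X + 'X) *: cst L;
  W_products_LM : br L M = ('X%:P + a%:P%:P * 'X + b%:P%:P) *: cst M;
  W_products_ML : br M L =
    ((a - 1)%:P%:P * 'X%:P + a%:P%:P * 'X - b%:P%:P) *: cst M;
  W_products_MM : br M M = 0 }.

Section Compat.
Variables (K : fieldType) (a b : K) (A : lmodType {poly K}) (L M : A).
Hypothesis LM_basis : basis2 L M.
Variables (br m : A -> A -> lpoly A).
Hypotheses (brC : conformal br) (mC : conformal m).

Notation d := ('X%:P%:P : {poly {poly {poly K}}}).
Notation la := ('X%:P : {poly {poly {poly K}}}).
Notation mu := ('X : {poly {poly {poly K}}}).
Notation comb1 := (comb (cst L) (cst M)).
Implicit Types r s : {poly {poly {poly K}}}.

Hypothesis brW : W_products a b L M br.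

Definition compat x y z :=
  prodatr m la mu x (br y z) *+ 2 =
  prodatl br (la + mu) la (m x y) z + prodatr br mu la y (m x z).

Let evLL r s : ev2 r s ('X%:P + 'X + 'X) = r + s + s.
Proof. by rewrite !ev2D ev2C ev1X ev2X. Qed.
Let evLM r s :
  ev2 r s ('X%:P + a%:P%:P * 'X + b%:P%:P) = r + cst3 a * s + cst3 b.
Proof. by rewrite ev2D ev2D ev2M !ev2C !ev1C ev1X ev2X. Qed.
Let evML r s :
  ev2 r s ((a - 1)%:P%:P * 'X%:P + a%:P%:P * 'X - b%:P%:P) =
  cst3 (a - 1) * r + cst3 a * s - cst3 b.
Proof. by rewrite ev2D ev2D ev2M ev2M ev2N !ev2C !ev1C ev1X ev2X. Qed.

Let atLL r : prodat br r L L = (d + r + r) *: cst2 L.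
Proof. by rewrite (prodat_scale_cst _ (W_products_LL brW)) evLL. Qed.
Let atLM r : prodat br r L M = (d + cst3 a * r + cst3 b) *: cst2 M.
Proof. by rewrite (prodat_scale_cst _ (W_products_LM brW)) evLM. Qed.
Let atML r :
  prodat br r M L = (cst3 (a - 1) * d + cst3 a * r - cst3 b) *: cst2 M.
Proof. by rewrite (prodat_scale_cst _ (W_products_ML brW)) evML. Qed.
Let atMM r : prodat br r M M = 0.
Proof. by rewrite /prodat (W_products_MM brW) (subst0 (@cst2B K A)). Qed.

Let basis : basis2 (cst2 L) (cst2 M) := basis2_cst (basis2_cst LM_basis).

Section CompatEquations.
Variables (x : A) (P Q H N : {poly {poly K}}).
Hypothesis mxL : m x L = comb1 P Q.
Hypothesis mxM : m x M = comb1 H N.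

Lemma compatLL_coord : compat x L L <->
  ((d + la + mu + mu) * ev2 d la P) *+ 2 =
    ev2 (- (la + mu)) la P * (d + (la + mu) + (la + mu)) +
    ev2 (d + mu) la P * (d + mu + mu) /\
  ((d + la + mu + mu) * ev2 d la Q) *+ 2 =
    ev2 (- (la + mu)) la Q * (cst3 (a - 1) * d + cst3 a * (la + mu) - cst3 b) +
    ev2 (d + mu) la Q * (d + cst3 a * mu + cst3 b).
Proof.
rewrite /compat (W_products_LL brW) prodatr_scale_cst // evLL.
rewrite (prodat_comb _ mxL) mxL prodatl_comb // prodatr_comb // atML !atLL atLM.
exact: (free_compatLL basis).
Qed.

Lemma compatLM_coord : compat x L M <->
  ((d + la + cst3 a * mu + cst3 b) * ev2 d la H) *+ 2 =
    ev2 (d + mu) la H * (d + mu + mu) /\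
  ((d + la + cst3 a * mu + cst3 b) * ev2 d la N) *+ 2 =
    ev2 (- (la + mu)) la P * (d + cst3 a * (la + mu) + cst3 b) +
    ev2 (d + mu) la N * (d + cst3 a * mu + cst3 b).
Proof.
rewrite /compat (W_products_LM brW) prodatr_scale_cst // evLM.
rewrite (prodat_comb _ mxM) mxL mxM prodatl_comb // prodatr_comb //.
rewrite atLL !atLM atMM.
exact: (free_compatLM basis).
Qed.

Lemma compatML_coord : compat x M L <->
  ((cst3 (a - 1) * (d + la) + cst3 a * mu - cst3 b) * ev2 d la H) *+ 2 =
    ev2 (- (la + mu)) la H * (d + (la + mu) + (la + mu)) /\
  ((cst3 (a - 1) * (d + la) + cst3 a * mu - cst3 b) * ev2 d la N) *+ 2 =
    ev2 (- (la + mu)) la N * (cst3 (a - 1) * d + cst3 a * (la + mu) - cst3 b) +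
    ev2 (d + mu) la P * (cst3 (a - 1) * d + cst3 a * mu - cst3 b).
Proof.
rewrite /compat (W_products_ML brW) prodatr_scale_cst // evML.
rewrite (prodat_comb _ mxM) mxL mxM prodatl_comb // prodatr_comb //.
rewrite atLL !atML atMM.
exact: (free_compatML basis).
Qed.

Lemma compatMM_coord : compat x M M <->
  0 = ev2 (- (la + mu)) la H * (d + cst3 a * (la + mu) + cst3 b) +
      ev2 (d + mu) la H * (cst3 (a - 1) * d + cst3 a * mu - cst3 b).
Proof.
rewrite /compat (W_products_MM brW) (prodatr0 mC).
rewrite mxM prodatl_comb // prodatr_comb // atML atLM !atMM.
exact: (free_compatMM basis).
Qed.

(** The compatibility equations for (x, L, L) and (x, L, M) at the point
    ∂ = u, λ = v, μ = 0 of an arbitrary K-algebra T. *)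
Section At.
Variables (T : comNzRingType) (iota : {rmorphism K -> T}) (u v : T).
Local Notation at2 := (at2 iota).
Local Notation at3 := (at3 iota u v 0).
Local Notation S3 := {poly {poly {poly K}}}.

Let at_diag R : at3 (ev2 (- (la + mu)) la R) = at2 (- v) v R.
Proof. by rewrite at3_ev2 at3N at3D at3X at3Y addr0. Qed.
Let at_shift R : at3 (ev2 (d + mu) la R) = at2 u v R.
Proof. by rewrite at3_ev2 at3D at3X at3Y at3Z addr0. Qed.
Let at_id R : at3 (ev2 d la R) = at2 u v R.
Proof. by rewrite at3_ev2 at3Y at3Z. Qed.

Let eX : at3 mu = 0. Proof. exact: at3X. Qed.
Let eY : at3 la = v. Proof. exact: at3Y. Qed.
Let eZ : at3 d = u. Proof. exact: at3Z. Qed.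
Let eC c : at3 (cst3 c) = iota c. Proof. exact: at3C. Qed.

Lemma compatLL_at : compat x L L ->
  ((u + v) * at2 u v P) *+ 2 =
    at2 (- v) v P * (u + v + v) + at2 u v P * u /\
  ((u + v) * at2 u v Q) *+ 2 =
    at2 (- v) v Q * (iota (a - 1) * u + iota a * v - iota b) +
    at2 u v Q * (u + iota b).
Proof.
case/compatLL_coord => e1 e2; split.
  have := rmorph_LL_coordL (S := S3) (e := at3)
    (d := d) (l := la) (m := mu) eZ eY eX
    (at_id P) (at_diag P) (at_shift P) e1.
  by rewrite !addr0.
have := rmorph_LL_coordM (S := S3) (e := at3)
  (d := d) (l := la) (m := mu) (eC a) (eC b) (eC (a - 1)) eZ eY eX
  (at_id Q) (at_diag Q) (at_shift Q) e2.
by rewrite mulr0 !addr0.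
Qed.

Lemma compatLM_at : compat x L M ->
  ((u + v + iota b) * at2 u v H) *+ 2 = at2 u v H * u /\
  ((u + v + iota b) * at2 u v N) *+ 2 =
    at2 (- v) v P * (u + iota a * v + iota b) + at2 u v N * (u + iota b).
Proof.
case/compatLM_coord => e1 e2; split.
  have := rmorph_LM_coordL (S := S3) (e := at3)
    (d := d) (l := la) (m := mu) (eC a) (eC b) eZ eY eX
    (at_id H) (at_shift H) e1.
  by rewrite mulr0 !addr0.
have := rmorph_LM_coordM (S := S3) (e := at3)
  (d := d) (l := la) (m := mu) (eC a) (eC b) eZ eY eX
  (at_id N) (at_diag P) (at_shift N) e2.
by rewrite mulr0 !addr0.
Qed.
End At.
End CompatEquations.

(** At the generic point (∂, λ) each equation is solved by cancelling a factor
    c + 2λ with c nonzero in K[∂].  The case a <> 2 needs a second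
    specialisation, to K[λ], at the root of the factor in question. *)
Lemma compat_products x : compat x L L -> compat x L M ->
  exists f g : {poly K}, [/\ m x L = comb1 f^:P g^:P,
    m x M = f^:P *: cst M & a <> 2%:R -> f = 0 /\ g = 0].
Proof.
move=> cLL cLM; have [span1 _] := basis2_cst LM_basis.
have [P [Q mxL]] := span1 (m x L); have [H [N mxM]] := span1 (m x M).
have at_LL := compatLL_at mxL; have at_LM := compatLM_at mxL mxM.
pose cc : {rmorphism K -> {poly {poly K}}} := polyC \o polyC.
have nz (c : {poly K}) : c != 0 -> c%:P + 'X *+ 2 != 0.
  apply: contra_neq => /(congr1 (fun P => P.[0])).
  by rewrite hornerD hornerC hornerMn hornerX mul0rn addr0 horner0.
have nzX (c : K) : 'X + c%:P != 0 by rewrite -[c]opprK polyCN polyXsubC_eq0.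
have [eP eQ] := at_LL _ cc 'X%:P 'X cLL.
have [eH eN] := at_LM _ cc 'X%:P 'X cLM.
move: eP eQ eH eN; rewrite !at2_id !at2_diag => eP eQ eH eN.
have nLL1 : 'X%:P + 'X *+ 2 != 0 :> {poly {poly K}} by rewrite nz ?polyX_eq0.
have nLL2 : 'X%:P + 'X *+ 2 - cc b != 0.
  by rewrite addrAC -polyCB nz ?polyXsubC_eq0.
have nLM1 : 'X%:P + ('X + cc b) *+ 2 != 0.
  rewrite mulrnDl addrCA addrC -polyCMn -polyCD nz //.
  by rewrite -polyCMn nzX.
have nLM2 : 'X%:P + 'X *+ 2 + cc b != 0.
  by rewrite addrAC -polyCD nz // nzX.
have {eP}eP := solve_LL_coordL nLL1 eP.
have {eH}eH := solve_LM_coordL nLM1 eH.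
have [a2|a2] := eqVneq a 2%:R.
  have ca : cc a = 1 *+ 2 by rewrite a2 rmorph_nat.
  have ca1 : cc (a - 1) = 1 *+ 2 - 1 by rewrite rmorphB rmorph1 ca.
  rewrite ca1 ca in eQ; rewrite ca in eN.
  have {}eQ := solve_LL_coordM nLL2 eQ; have {}eN := solve_LM_coordM nLM2 eN.
  exists (at2 polyC (- 'X) 'X P), (at2 polyC (- 'X) 'X Q).
  by split=> [||//]; rewrite ?mxL ?mxM ?(combR (cst L)) ?eH ?eN -?eP -?eQ.
(* Now Q(-λ, λ) = P(-λ, λ) = 0, from the values at ∂ = b - 2λ and -b - 2λ. *)
have nz2 : 1 *+ 2 - a%:P != 0 :> {poly K}.
  by rewrite -polyCMn -polyCB polyC_eq0 subr_eq0 eq_sym.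
have Q0 : at2 polyC (- 'X) 'X Q = 0.
  have [_] := at_LL _ polyC (b%:P - 'X *+ 2) 'X cLL.
  rewrite /= polyCB polyC1.
  apply: (@solve_LL_diag _ 'X _ _ a%:P b%:P).
  by rewrite mulf_neq0 ?polyXsubC_eq0.
have P0 : at2 polyC (- 'X) 'X P = 0.
  have [_] := at_LM _ polyC (- b%:P - 'X *+ 2) 'X cLM.
  by apply: (@solve_LM_diag _ 'X _ _ a%:P b%:P); rewrite mulf_neq0 ?polyX_eq0.
rewrite Q0 rmorph0 in eQ; rewrite P0 rmorph0 in eP eN.
have {}eQ := solve_LL_coordM_zero nLL2 eQ.
have {}eN := solve_LM_coordM_zero nLM2 eN.
by exists 0, 0; rewrite !rmorph0 mxL mxM eP eQ eH eN scale0r comb0.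
Qed.

(** Conversely, with ∂-free coefficients of this form the equations in
    K[∂][λ][μ] are polynomial identities in the values of f and g at λ. *)
Lemma compat_of_products x (f g : {poly K}) :
  m x L = comb1 f^:P g^:P -> m x M = f^:P *: cst M ->
  a = 2%:R \/ f = 0 /\ g = 0 ->
  forall y z, y \in [:: L; M] -> z \in [:: L; M] -> compat x y z.
Proof.
move=> mxL; rewrite (combR (cst L)) => mxM afg.
have LLc := compatLL_coord mxL; have LMc := compatLM_coord mxL mxM.
have MLc := compatML_coord mxL mxM; have MMc := compatMM_coord mxM.
rewrite !ev2_const !ev20 in LLc LMc MLc MMc.
have [ca fg] : cst3 (a - 1) = cst3 a - 1 /\
    (cst3 a = 1 *+ 2 \/ ev1 'X%:P f = 0 /\ ev1 'X%:P g = 0).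
  split; first exact: cst3B1.
  by case: afg => [->|[-> ->]]; [left; exact: cst3_2|right; rewrite !ev10].
rewrite ca in LLc MLc.
move=> y z; rewrite !inE => /orP[]/eqP-> /orP[]/eqP->.
- by apply/LLc; exact: verify_LL fg.
- by apply/LMc; exact: verify_LM fg.
- by apply/MLc; exact: (@verify_ML _ d la mu (cst3 a) (cst3 b) _ _ fg).
- by apply/MMc; exact: verify_MM.
Qed.
End Compat.

(** * Associativity on the generators *)

(** Coordinates of the associativity identity for (x, L, L), (x, L, M),
    (x, M, L) and (x, M, M). *)
Section FreeAssoc.
Variables (S : nzRingType) (V : lmodType S) (u v : V).
Hypothesis uv_basis : basis2 u v.

Let eqEv q q' : q *: v = q' *: v <-> q = q'.
Proof. by rewrite !(combR u) (basis2_eq uv_basis); split=> [[]|->]. Qed.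

Lemma free_assocLL c1 c2 s t e1 s3 t3 e2 s4 t4 :
  c1 *: comb u v s t + c2 *: (s *: v) =
    e1 *: comb u v s3 t3 + e2 *: comb u v s4 t4 <->
  c1 * s = e1 * s3 + e2 * s4 /\ c1 * t + c2 * s = e1 * t3 + e2 * t4.
Proof.
by rewrite (combR u v s) !combZ !combD mulr0 addr0 (basis2_eq uv_basis).
Qed.

Lemma free_assocLM c1 s e1 s3 e2 s4 :
  c1 *: (s *: v) = e1 *: (s3 *: v) + e2 *: (s4 *: v) <->
  c1 * s = e1 * s3 + e2 * s4.
Proof. by rewrite !scalerA -scalerDl eqEv. Qed.

Lemma free_assocML c1 c2 s t e1 s3 t3 :
  c1 *: comb u v s t + c2 *: (s *: v) = e1 *: comb u v s3 t3 <->
  c1 * s = e1 * s3 /\ c1 * t + c2 * s = e1 * t3.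
Proof.
by rewrite (combR u v s) !combZ !combD mulr0 addr0 (basis2_eq uv_basis).
Qed.

Lemma free_assocMM c1 s e1 s3 :
  c1 *: (s *: v) = e1 *: (s3 *: v) <-> c1 * s = e1 * s3.
Proof. by rewrite !scalerA eqEv. Qed.
End FreeAssoc.

Section AssocEquations.
Variables (K : fieldType) (f g p q : {poly K}).
Variables (T : comNzRingType) (iota : {rmorphism K -> T}) (l m : T).
Local Notation at_ := (horner_at iota).

(** The coordinates of F_L(μ) F_x(λ) = h(λ) F_L(λ+μ) + k(λ) F_M(λ+μ) and of
    F_M(μ) F_x(λ) = h(λ) F_M(λ+μ) at λ = l, μ = m, where F_L = f + gε,
    F_M = p + qε and F_x = h + kε. *)
Definition assoc_left (h k : {poly K}) : Prop :=
  [/\ at_ m f * at_ l h = at_ l h * at_ (l + m) f + at_ l k * at_ (l + m) p,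
      at_ m f * at_ l k + at_ m g * at_ l h =
        at_ l h * at_ (l + m) g + at_ l k * at_ (l + m) q,
      at_ m p * at_ l h = at_ l h * at_ (l + m) p &
      at_ m p * at_ l k + at_ m q * at_ l h = at_ l h * at_ (l + m) q].

Definition assoc_equations : Prop := assoc_left f g /\ assoc_left p q.
End AssocEquations.

Section Assoc.
Variables (K : fieldType) (A : lmodType {poly K}) (L M : A).
Hypothesis LM_basis : basis2 L M.
Variables (prd : A -> A -> lpoly A).
Hypothesis mC : conformal prd.
Notation d := ('X%:P%:P : {poly {poly {poly K}}}).
Notation la := ('X%:P : {poly {poly {poly K}}}).
Notation mu := ('X : {poly {poly {poly K}}}).
Notation comb1 := (comb (cst L) (cst M)).

Definition assoc x y z :=
  prodatr prd la mu x (prd y z) = prodatl prd (la + mu) la (prd x y) z.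

Variables (f g p q : {poly K}).
Hypothesis LLe : prd L L = comb1 f^:P g^:P.
Hypothesis LMe : prd L M = f^:P *: cst M.
Hypothesis MLe : prd M L = comb1 p^:P q^:P.
Hypothesis MMe : prd M M = p^:P *: cst M.

Section Left.
Variables (x : A) (h k : {poly K}).
Hypothesis xL : prd x L = comb1 h^:P k^:P.
Hypothesis xM : prd x M = h^:P *: cst M.

Let basis : basis2 (cst2 L) (cst2 M) := basis2_cst (basis2_cst LM_basis).

Let at_comb r y s t : prd y L = comb1 s^:P t^:P ->
  prodat prd r y L = comb (cst2 L) (cst2 M) (ev1 r s) (ev1 r t).
Proof. by move=> e; rewrite (prodat_comb _ e) !ev2_const. Qed.

Let at_scale r y s : prd y M = s^:P *: cst M ->
  prodat prd r y M = ev1 r s *: cst2 M.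
Proof. by move=> e; rewrite (prodat_scale_cst _ e) ev2_const. Qed.

(** The equation for (x, L, M) is one of the two for (x, L, L), and likewise for
    (x, M, M): the products by x, L and M on the left are linear over K[ε], and
    M = ε L. *)
Lemma assoc_left_generators :
  (forall y z, y \in [:: L; M] -> z \in [:: L; M] -> assoc x y z) <->
  assoc_left f g p q cst3 la mu h k.
Proof.
have aLL : assoc x L L <->
    ev1 mu f * ev1 la h =
    ev1 la h * ev1 (la + mu) f + ev1 la k * ev1 (la + mu) p /\
    ev1 mu f * ev1 la k + ev1 mu g * ev1 la h =
    ev1 la h * ev1 (la + mu) g + ev1 la k * ev1 (la + mu) q.
  rewrite /assoc xL LLe prodatr_comb // prodatl_comb // !ev2_const.
  rewrite (at_comb _ xL) (at_scale _ xM) (at_comb _ LLe) (at_comb _ MLe).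
  exact: (free_assocLL basis).
have aLM : assoc x L M <->
    ev1 mu f * ev1 la h =
    ev1 la h * ev1 (la + mu) f + ev1 la k * ev1 (la + mu) p.
  rewrite /assoc xL LMe prodatr_scale_cst // prodatl_comb // !ev2_const.
  rewrite (at_scale _ xM) (at_scale _ LMe) (at_scale _ MMe).
  exact: (free_assocLM basis).
have aML : assoc x M L <->
    ev1 mu p * ev1 la h = ev1 la h * ev1 (la + mu) p /\
    ev1 mu p * ev1 la k + ev1 mu q * ev1 la h =
    ev1 la h * ev1 (la + mu) q.
  rewrite /assoc xM MLe prodatr_comb //.
  rewrite (prodatl_scalel mC) (prodatl_cst mC) !ev2_const.
  rewrite (at_comb _ xL) (at_scale _ xM) (at_comb _ MLe).
  exact: (free_assocML basis).
have aMM : assoc x M M <->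
    ev1 mu p * ev1 la h = ev1 la h * ev1 (la + mu) p.
  rewrite /assoc xM MMe prodatr_scale_cst //.
  rewrite (prodatl_scalel mC) (prodatl_cst mC) !ev2_const.
  rewrite (at_scale _ xM) (at_scale _ MMe).
  exact: (free_assocMM basis).
split=> [ass|[e1 e2 e3 e4] y z].
  have inL : L \in [:: L; M] by rewrite inE eqxx.
  have inM : M \in [:: L; M] by rewrite !inE eqxx orbT.
  have [e1 e2] := proj1 aLL (ass _ _ inL inL).
  have [e3 e4] := proj1 aML (ass _ _ inM inL).
  by split.
rewrite !inE => /orP[]/eqP-> /orP[]/eqP->.
- by apply/aLL.
- by apply/aLM.
- by apply/aML.
- by apply/aMM.
Qed.
End Left.

Lemma assoc_generators :
  (forall x y z, x \in [:: L; M] -> y \in [:: L; M] -> z \in [:: L; M] ->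
     assoc x y z) <->
  assoc_equations f g p q cst3 la mu.
Proof.
split=> [ass|[eL eM] x y z].
  by split; [apply/(assoc_left_generators LLe LMe)
           | apply/(assoc_left_generators MLe MMe)];
    move=> y z; apply: ass; rewrite !inE eqxx ?orbT.
rewrite inE => /orP[/eqP->|].
  exact: (proj2 (assoc_left_generators LLe LMe) eL).
rewrite mem_seq1 => /eqP->.
exact: (proj2 (assoc_left_generators MLe MMe) eM).
Qed.
End Assoc.

Section RmorphAssoc.
Variables (S : nzRingType) (T : comNzRingType) (e : {rmorphism S -> T}).
Variables (a b c d u v w z : S) (a' b' c' d' u' v' w' z' : T).
Hypotheses (ea : e a = a') (eb : e b = b') (ec : e c = c') (ed : e d = d').
Hypotheses (eu : e u = u') (ev : e v = v') (ew : e w = w') (ez : e z = z').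

Lemma rmorph_mul_mul : a * b = c * d -> a' * b' = c' * d'.
Proof. by rewrite -ea -eb -ec -ed -!rmorphM => ->. Qed.

Lemma rmorph_mul_add : a * b = c * d + u * v -> a' * b' = c' * d' + u' * v'.
Proof.
by rewrite -ea -eb -ec -ed -eu -ev -!rmorphM -rmorphD => ->.
Qed.

Lemma rmorph_add_mul : a * b + u * v = c * d -> a' * b' + u' * v' = c' * d'.
Proof.
by rewrite -ea -eb -ec -ed -eu -ev -!rmorphM -rmorphD => ->.
Qed.

Lemma rmorph_add_add : a * b + u * v = c * d + w * z ->
  a' * b' + u' * v' = c' * d' + w' * z'.
Proof.
by rewrite -ea -eb -ec -ed -eu -ev -ew -ez -!rmorphM -!rmorphD => ->.
Qed.
End RmorphAssoc.

Section AssocTransfer.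
Variables (K : fieldType) (f g p q : {poly K}).
Variables (T : comNzRingType) (iota : {rmorphism K -> T}) (l m : T).

(** The associativity equations are identities in λ and μ, so they hold for any
    two elements of any K-algebra. *)
Lemma assoc_equations_at :
  assoc_equations f g p q cst3 'X%:P 'X -> assoc_equations f g p q iota l m.
Proof.
have tr (h k : {poly K}) : assoc_left f g p q cst3 'X%:P 'X h k ->
    assoc_left f g p q iota l m h k; last by move=> [e1 e2]; split; apply: tr.
have atl (r : {poly K}) : at3 iota 0 l m (ev1 'X%:P r) = horner_at iota l r.
  by rewrite at3_ev1 at3Y.
have atm (r : {poly K}) : at3 iota 0 l m (ev1 'X r) = horner_at iota m r.
  by rewrite at3_ev1 at3X.
have atlm (r : {poly K}) :
    at3 iota 0 l m (ev1 ('X%:P + 'X) r) = horner_at iota (l + m) r.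
  by rewrite at3_ev1 at3D at3X at3Y.
pose e : {rmorphism {poly {poly {poly K}}} -> T} := at3 iota 0 l m.
case=> e1 e2 e3 e4; split.
- exact: (rmorph_mul_add (e := e)
    (atm f) (atl h) (atl h) (atlm f) (atl k) (atlm p) e1).
- exact: (rmorph_add_add (e := e)
    (atm f) (atl k) (atl h) (atlm g) (atm g) (atl h) (atl k) (atlm q) e2).
- exact: (rmorph_mul_mul (e := e)
    (atm p) (atl h) (atl h) (atlm p) e3).
- exact: (rmorph_add_mul (e := e)
    (atm p) (atl k) (atl h) (atlm q) (atm q) (atl h) e4).
Qed.
End AssocTransfer.

Section AssocSolve.
Variables (K : fieldType).
Implicit Types (f g p q h : {poly K}).

(** Comparing coefficients: 2^i h_i = 2 h_i forces h_i = 0 for i <> 1. *)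
Lemma double_linear h : (forall n, (n%:R == 0 :> K) = (n == 0)%N) ->
  h \Po ('X + 'X) = h + h -> h = h`_1 *: 'X.
Proof.
move=> char0 e; apply/polyP => i; rewrite coefZ coefX.
have : (h \Po (2%:R *: 'X))`_i = 2%:R ^+ i * h`_i.
  rewrite comp_polyE coef_sum.
  have [lt_i|le_i] := ltnP i (size h).
    rewrite (bigD1 (Ordinal lt_i)) //= big1 ?addr0 => [|j ne_ji].
      by rewrite exprZn !coefZ coefXn eqxx mulr1 mulrC.
    have /negPf nij : i != j.
      by apply: contraNneq ne_ji => ij; apply/eqP/val_inj.
    by rewrite exprZn !coefZ coefXn nij !mulr0.
  rewrite [h`_i]nth_default // mulr0 big1 // => j _.
  by rewrite exprZn !coefZ coefXn gtn_eqF ?mulr0 // (leq_trans (ltn_ord j)).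
rewrite scaler_nat mulr2n e coefD => {}e.
have [->|ne_i1] := eqVneq i 1%N; first by rewrite mulr1.
rewrite mulr0; apply/eqP.
have : (2%:R ^+ i - 2%:R) * h`_i = 0.
  by rewrite mulrBl -e mulr_natl mulr2n subrr.
move/eqP; rewrite mulf_eq0 => /orP[|//].
case: i ne_i1 {e} => [|[//|i]] _.
  by rewrite expr0 -opprB oppr_eq0 -(natrB _ (isT : 1 <= 2)%N) char0.
rewrite -natrX -natrB ?char0; first by rewrite subn_eq0 (leq_exp2l _ 1).
by rewrite (leq_exp2l 1).
Qed.

Definition assoc_solution f g p q : Prop :=
  [\/ [/\ f = 0, p = 0 & q = 0],
      exists c1 c2 : K, c1 <> 0 /\
        [/\ f = c1%:P, g = c2 *: 'X, p = 0 & q = 0],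
      exists c1 c3 : K, c1 <> 0 /\
        [/\ f = c1%:P, g = c3%:P, p = 0 & q = c1%:P] |
      exists c0 m k : K, c0 <> 0 /\
        [/\ f = m%:P - k *: 'X,
            g = (k * m / c0) *: 'X - (k ^+ 2 / c0) *: 'X^2,
            p = c0%:P & q = k *: 'X]].

(** The specialisation μ = 0 gives all the equations used here but two; these
    are additivity statements, for which μ = λ serves. *)
Lemma assoc_equations_solved f g p q :
  (forall n, (n%:R == 0 :> K) = (n == 0)%N) ->
  assoc_equations f g p q cst3 'X%:P 'X -> assoc_solution f g p q.
Proof.
move=> char0 eqs.
have at2X h : horner_at polyC ('X + 'X) h = h \Po ('X + 'X) by [].
have [eL eM] := assoc_equations_at polyC 'X 0 eqs.
have [eL' eM'] := assoc_equations_at polyC 'X 'X eqs.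
case: eL eM eL' eM' {eqs} => LL1 LL2 LM1 LM2 [ML1 ML2 MM1 MM2].
move=> [_ LL2' _ _] [_ _ _ MM2'].
rewrite !addr0 !horner_at_id !horner_at_polyC0
  in LL1 LL2 LM1 LM2 ML1 ML2 MM1 MM2.
rewrite !at2X !horner_at_id in LL2' MM2'.
have [p0|pN0] := eqVneq p 0; last first.
  (* Here p(0) p = p p, so p is a nonzero constant; then q is additive, and
     f and g follow from q by division by p. *)
  have ep : p = p.[0]%:P by apply: (cancel_factor pN0 (esym MM1)); ring.
  have c0N0 : p.[0] != 0 by rewrite -polyC_eq0 -ep.
  have [k eq] : exists k, q = k *: 'X.
    exists q`_1; apply: double_linear => //.
    by apply: (cancel_factor pN0 (esym MM2')); ring.
  have q0 : q.[0] = 0 by rewrite eq hornerZ hornerX mulr0.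
  have ef : f = f.[0]%:P - q by apply: (cancel_factor pN0 (esym ML1)); ring.
  have eg : g = p.[0]^-1%:P * (f * q).
    apply: (cancel_factor pN0 LM2); rewrite q0 polyC0 mul0r addr0 {1}ep.
    by rewrite mulrBr [_ * (_^-1%:P * _)]mulrA -polyCM divff // mul1r.
  apply: Or44; exists p.[0], f.[0], k; split; first exact/eqP.
  split=> //; first by rewrite -eq.
  by rewrite eg {1}ef eq expr2 -!mul_polyC !polyCM; ring.
subst p; rewrite horner0 polyC0 in LL1 LL2 LM2 ML2.
have [q0|qN0] := eqVneq q 0.
  (* F_M = 0: f is constant, and if it is nonzero then g is additive. *)
  subst q; have [f0|fN0] := eqVneq f 0; first exact: Or41.
  have ef : f = f.[0]%:P by apply: (cancel_factor fN0 (esym LL1)); ring.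
  apply: Or42; exists f.[0], g`_1.
  split; first by apply/eqP; rewrite -polyC_eq0 -ef.
  split=> //; apply: double_linear => //.
  by apply: (cancel_factor fN0 (esym LL2')); ring.
(* F_M is a nonzero multiple of ε: q, f and g are constant. *)
have eq : q = f.[0]%:P by apply: (cancel_factor qN0 (esym ML2)); ring.
have c1N0 : f.[0]%:P != 0 :> {poly K} by rewrite -eq.
have fN0 : f != 0 by apply: contra_neq c1N0 => ->; rewrite horner0.
have ef : f = f.[0]%:P by apply: (cancel_factor fN0 (esym LL1)); ring.
apply: Or43; exists f.[0], g.[0]; split; first by apply/eqP; rewrite -polyC_eq0.
split=> //; rewrite eq in LL2.
by apply: (cancel_factor fN0 (esym LL2)); ring.
Qed.

Section Check.
Variables (T : comNzRingType) (iota : {rmorphism K -> T}) (l m : T).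

Let horner_atZ r c h : horner_at iota r (c *: h) = iota c * horner_at iota r h.
Proof. by rewrite -mul_polyC !horner_atE. Qed.

Let horner_atB r h k :
  horner_at iota r (h - k) = horner_at iota r h - horner_at iota r k.
Proof. exact: rmorphB. Qed.

Let horner_atXX r : horner_at iota r 'X^2 = r * r.
Proof. by rewrite expr2 !horner_atE. Qed.

Lemma assoc_solution_equations f g p q :
  assoc_solution f g p q -> assoc_equations f g p q iota l m.
Proof.
case=> [[-> -> ->]|[c1 [c2 [_ [-> -> -> ->]]]]|[c1 [c3 [_ [-> -> -> ->]]]]|].
- by split; split; rewrite !horner_at0; ring.
- by split; split;
    rewrite !(horner_at0, horner_atC, horner_atZ, horner_atX); ring.
- by split; split;
    rewrite !(horner_at0, horner_atC, horner_atZ, horner_atX); ring.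
move=> [c0 [n [k [/eqP c0N0 [-> -> -> ->]]]]].
(* With t the image of k / c0, the image of k is t c0: no division remains. *)
have ek : iota k = iota (k / c0) * iota c0 by rewrite -rmorphM divfK.
have e1 : iota (k * n / c0) = iota (k / c0) * iota n.
  by rewrite -rmorphM mulrAC.
have e2 : iota (k ^+ 2 / c0) = iota (k / c0) * iota (k / c0) * iota c0.
  by rewrite -!rmorphM; congr (iota _); field.
by split; split;
  rewrite !(horner_atB, horner_atC, horner_atZ, horner_atX, horner_atXX)
    ?e1 ?e2 ?ek; ring.
Qed.
End Check.
End AssocSolve.

(** * The classification *)

Section Classification.
Variables (K : fieldType) (a b : K) (A : lmodType {poly K}) (L M : A).
Hypothesis char0 : forall n, (n%:R == 0 :> K) = (n == 0)%N.
Hypothesis LM_basis : basis2 L M.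
Variables (br prd : A -> A -> lpoly A).
Hypotheses (brC : conformal br) (mC : conformal prd).
Hypothesis brW : W_products a b L M br.

Definition gen_form (f g p q : {poly K}) : Prop :=
  [/\ prd L L = lterm f L + lterm g M, prd L M = lterm f M,
      prd M L = lterm p L + lterm q M & prd M M = lterm p M].

(** The pairs f, g and p, q describe the products by L and by M on the left:
    compatibility treats each pair separately, associativity relates them. *)
Lemma tpca_classification :
  (forall x y z, assoc prd x y z) /\ (forall x y z, compat br prd x y z) <->
  exists f g p q, [/\ gen_form f g p q,
    a <> 2%:R -> [/\ f = 0, g = 0, p = 0 & q = 0] & assoc_solution f g p q].
Proof.
have [span _] := LM_basis.
split=> [[ass cmp]|[f [g [p [q [[LLe LMe MLe MMe] a2 sol]]]]]].
  have [f [g [LLe LMe fg0]]] :=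
    compat_products LM_basis brC mC brW (cmp L L L) (cmp L L M).
  have [p [q [MLe MMe pq0]]] :=
    compat_products LM_basis brC mC brW (cmp M L L) (cmp M L M).
  exists f, g, p, q; split=> [||].
  - by split.
  - by move=> a2; case: (fg0 a2) => -> ->; case: (pq0 a2).
  - apply: assoc_equations_solved => //.
    by apply/(assoc_generators LM_basis mC LLe LMe MLe MMe).
split.
  apply: (sesquitrilinear_eq span (sesquitrilinear_prodatr mC mC)
                                  (sesquitrilinear_prodatl mC mC)).
  apply/(assoc_generators LM_basis mC LLe LMe MLe MMe).
  exact: assoc_solution_equations.
have sl := sesquitrilinearD (sesquitrilinear_prodatr mC brC)
                            (sesquitrilinear_prodatr mC brC).
have sr := sesquitrilinearD (sesquitrilinear_prodatl brC mC)
                            (sesquitrilinear_prodatr_swap brC mC).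
move=> x y z; rewrite /compat mulr2n.
apply: (sesquitrilinear_eq span sl sr) => {x y z} x y z.
have aE : a = 2%:R \/ a <> 2%:R.
  by case: (eqVneq a 2%:R) => [|/eqP]; [left|right].
rewrite inE => /orP[/eqP->|]; last rewrite mem_seq1 => /eqP->.
  move=> yLM zLM; rewrite -mulr2n.
  apply: (compat_of_products LM_basis brC mC brW LLe LMe) => //.
  by case: aE => [|/a2[]]; [left|right].
move=> yLM zLM; rewrite -mulr2n.
apply: (compat_of_products LM_basis brC mC brW MLe MMe) => //.
by case: aE => [|/a2[]]; [left|right].
Qed.
End Classification.

Lemma W_tpca_classification (K : fieldType) (a b : K)
    (prd : 'rV[{poly K}]_2 -> 'rV[{poly K}]_2 -> lpoly 'rV[{poly K}]_2) :
  (forall n, (n%:R == 0 :> K) = (n == 0)%N) -> conformal prd ->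
  (forall x y z, assoc prd x y z) /\
    (forall x y z, compat (W_bracket a b) prd x y z) <->
  exists f g p q, [/\ gen_form genL genM prd f g p q,
    a <> 2%:R -> [/\ f = 0, g = 0, p = 0 & q = 0] & assoc_solution f g p q].
Proof.
move=> char0 mC.
apply: (tpca_classification (b := b) char0 (basis2_gen K) _ mC).
  exact: sesquilinear_conformal.
split.
- by rewrite W_bracketLL /W_LL mulr_natl mulr2n addrA.
- exact: W_bracketLM.
- by rewrite W_bracketML W_MLE.
- exact: W_bracketMM.
Qed.

Theorem theorem5p5 (R : realType) (a b : complexField R)
    (prd : W a b -> W a b -> lpoly (W a b)) :
  nc_tpca (A := W a b) prd <->
  conformal prd /\
  ((a <> 2%:R /\ gen_products prd 0 0 0 0) \/
   (a = 2%:R /\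
    [\/ exists s : {poly complexField R},
          gen_products prd (lterm s genM) 0 0 0,
        exists c1 c2 : complexField R, c1 <> 0 /\
          gen_products prd
            (lterm c1%:P genL + lterm (c2 *: 'X) genM) (lterm c1%:P genM)
            0 0,
        exists c1 c3 : complexField R, c1 <> 0 /\
          gen_products prd
            (lterm c1%:P genL + lterm c3%:P genM) (lterm c1%:P genM)
            (lterm c1%:P genM) 0 |
        exists c0 m k : complexField R, c0 <> 0 /\
          gen_products prd
            (lterm (m%:P - k *: 'X) genL +
             lterm ((k * m / c0) *: 'X - (k ^+ 2 / c0) *: 'X^2) genM)
            (lterm (m%:P - k *: 'X) genM)
            (lterm c0%:P genL + lterm (k *: 'X) genM)
            (lterm c0%:P genM)])).
Proof.
have char0 n : (n%:R == 0 :> complexField R) = (n == 0)%N.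
  exact: (@Num.Theory.pnatr_eq0 R[i] n).
apply: (iff_trans (B := conformal prd /\
    exists f g p q, [/\ gen_form genL genM prd f g p q,
      a <> 2%:R -> [/\ f = 0, g = 0, p = 0 & q = 0] &
      assoc_solution f g p q])).
  split=> [[[mC ass] cmp]|[mC sol]].
    split=> //; apply: (proj1 (W_tpca_classification a b char0 mC)).
    by split; [exact: ass | exact: cmp].
  have [ass cmp] := proj2 (W_tpca_classification a b char0 mC) sol.
  by split; first split.
have lterm0 (x : W a b) : lterm 0 x = 0 by rewrite /lterm rmorph0 scale0r.
split=> -[mC]; last first.
  move=> sol; split=> //; move: sol.
  case=> [[a2 [LL LM ML MM]]|
    [a2 [[s]|[c1 [c2 [c1N0]]]|[c1 [c3 [c1N0]]]|[c0 [m [k [c0N0]]]]]]].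
  - exists 0, 0, 0, 0; split; [|by []|exact: Or41].
    by rewrite /gen_form !lterm0 addr0.
  - case=> LL LM ML MM; exists 0, s, 0, 0; split; [|by case|exact: Or41].
    by rewrite /gen_form !lterm0 add0r addr0.
  - case=> LL LM ML MM; exists c1%:P, (c2 *: 'X), 0, 0.
    split; [|by case|by apply: Or42; exists c1, c2].
    by rewrite /gen_form !lterm0 addr0; split.
  - case=> LL LM ML MM; exists c1%:P, c3%:P, 0, c1%:P.
    split; [|by case|by apply: Or43; exists c1, c3].
    by rewrite /gen_form !lterm0 add0r; split.
  - case=> LL LM ML MM.
    exists (m%:P - k *: 'X), ((k * m / c0) *: 'X - (k ^+ 2 / c0) *: 'X^2),
      c0%:P, (k *: 'X).
    by split; [split|case|apply: Or44; exists c0, m, k].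
case=> f [g [p [q [[LL LM ML MM] a2 sol]]]]; split=> //.
have [ea|/eqP na] := eqVneq a 2%:R; last first.
  left; split=> //; have [f0 g0 p0 q0] := a2 na.
  by split; rewrite ?LL ?LM ?ML ?MM ?f0 ?g0 ?p0 ?q0 !lterm0 ?addr0.
right; split=> //.
case: sol => [[f0 p0 q0]|[c1 [c2 [c1N0 fgpq]]]|[c1 [c3 [c1N0 fgpq]]]|
  [c0 [m [k [c0N0 fgpq]]]]].
- apply: Or41; exists g.
  by split; rewrite ?LL ?LM ?ML ?MM ?f0 ?p0 ?q0 !lterm0 ?addr0 ?add0r.
- apply: Or42; exists c1, c2; split; first exact: c1N0.
  have [ef eg ep eq] := fgpq; rewrite ef eg ep eq ?lterm0 ?addr0 in LL LM ML MM.
  by split.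
- apply: Or43; exists c1, c3; split; first exact: c1N0.
  have [ef eg ep eq] := fgpq; rewrite ef eg ep eq ?lterm0 ?add0r in LL LM ML MM.
  by split.
- apply: Or44; exists c0, m, k; split; first exact: c0N0.
  have [ef eg ep eq] := fgpq; rewrite ef eg ep eq in LL LM ML MM.
  by split.
Qed.
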